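(* Let $X$ be a Fréchet sequence algebra under the coordinatewise product in which $\mathrm{span}\{e_i: i\ge 0\}$ is dense, let $d\geq 1$, let $\alpha\in(0,1/d)$, let $I\subset(0,+\infty)$ be $\sigma$-compact, and let $(w(a))_{a\in I}$ be a continuous family of admissible weights on $X$. Suppose that, for all integers $m'\geq 1$ and all compact sets $I_0\subset I$, there exist $C_1,C_2>0$, $\beta>\alpha d$, a function $F:\{1,2,3,\dots\}\to(0,+\infty)$ with $F(n)\leq C_1n^\alpha$ for all $n$, and $N_0,M_0>0$ such that, for all $n\geq N_0$, (i) the function $a\in I_0\mapsto\sum_{i=1}^n\log(w_i(a))$ is $F(n)$-Lipschitz; (ii) $\inf_{a\in I_0}w_1(a)\cdots w_k(a)\to+\infty$ as $k\to+\infty$; (iii) for all $a\in I_0$ and all $k\geq N_0$, $$\left\|\frac{\exp\Big(C_2\frac{F(n+k)}{(n+k)^\alpha}k^\alpha\Big)}{w_1(a)\cdots w_k(a)}\,e_k\right\|\leq\frac{M_0}{k^\beta}\qquad\text{and}\qquad \left\|\frac{1}{\big[w_1(a)\cdots w_k(a)\big]^{1/m'}}\,e_k\right\|\leq\frac{M_0}{k^\beta}.$$ Then the family $\big(B_{w(\lambda_1)}\times\cdots\times B_{w(\lambda_d)}\big)_{\lambda=(\lambda_1,\dots,\lambda_d)\in I^d}$ admits a common hypercyclic algebra on $X^d$ for the coordinatewise product.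
   Context: Let $\omega$ be the space of all complex sequences $(x_n)_{n\geq0}$ and let $e_i$ be the sequence with $1$ in position $i$ and $0$ elsewhere. A Fréchet sequence algebra is a Fréchet space $X\subset\omega$ (continuously included in $\omega$), whose complete topology is induced by a non-decreasing separating sequence of seminorms $(\|\cdot\|_q)_{q\geq1}$, endowed with a well-defined product $\cdot$ such that $\|x\cdot y\|_q\leq\|x\|_q\|y\|_q$ for all $x,y\in X$ and $q\geq1$. The coordinatewise product is $(a_n)_n\cdot(b_n)_n=(a_nb_n)_n$; $X^d$ is an algebra with this product applied in each of its $d$ components. The symbol $\|\cdot\|$ (without index) denotes the $F$-norm of $X$ inducing its topology; it satisfies, for all $u\in X$ and $\lambda\in\mathbb C$: $|\lambda|\leq1\Rightarrow\|\lambda u\|\leq\|u\|$; $\lim_{\lambda\to0}\|\lambda u\|=0$; $\|\lambda u\|\leq(|\lambda|+1)\|u\|$. A weight is a sequence $w=(w_n)_{n\geq 1}$ of positive real numbers; the weighted backward shift is $B_w(x_0,x_1,x_2,\dots)=(w_1x_1,w_2x_2,\dots)$, and $w$ is admissible if $B_w$ is a well-defined continuous operator on $X$. We write $w(a)=(w_n(a))_{n\geq1}$. The family is a continuous family: each $a\mapsto w_n(a)$ is continuous, and, with $T_\lambda=B_{w(\lambda_1)}\times\cdots\times B_{w(\lambda_d)}$ acting componentwise on $X^d$, the map $(\lambda,v)\mapsto T_\lambda(v)$ is continuous from $I^d\times X^d$ into $X^d$. A vector $x$ is hypercyclic for an operator $T$ if $\{T^n(x):n\geq 1\}$ is dense in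 the space; $HC(T)$ is the set of hypercyclic vectors of $T$. A family $(T_\lambda)_{\lambda\in\Lambda}$ of operators on a topological algebra $Y$ admits a common hypercyclic algebra if there is a non-trivial (i.e. nonzero) subalgebra $A$ of $Y$ with $A\setminus\{0\}\subset\bigcap_{\lambda\in\Lambda}HC(T_\lambda)$. *)

(* Defs.v *)
From HB Require Import structures.
From mathcomp Require Import all_boot all_order all_algebra.
From mathcomp Require Import complex.
From mathcomp Require Import all_classical all_reals all_analysis.

Set Implicit Arguments.
Unset Strict Implicit.
Unset Printing Implicit Defensive.

Import Order.TTheory GRing.Theory Num.Theory.
Import numFieldTopology.Exports numFieldNormedType.Exports.

Local Open Scope classical_set_scope.
Local Open Scope ring_scope.
Local Open Scope complex_scope.

Definition modulus (R : realType) (z : R[i]) : R := ComplexField.Normc.normc z.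

(* The inclusion of X into the space of complex sequences is the injective map
   [seq_coord]. Seminorms are indexed from 0 instead of 1. Completeness is
   stated with the seminorms, not with a library uniformity, because [tvsType]
   does not require its uniformity to be translation-invariant; sequences
   suffice since the topology is given by countably many seminorms. *)
Record coordwiseFrechetAlgebra (R : realType) (X : topologicalLmodType R[i]) :=
  CoordwiseFrechetAlgebra {
    seq_coord : X -> nat -> R[i] ;
    seq_coord_linear : forall (a : R[i]) (x y : X) (n : nat),
      seq_coord (a *: x + y) n = a * seq_coord x n + seq_coord y n ;
    seq_coord_inj : injective seq_coord ;
    seq_coord_continuous :
      continuous (seq_coord : X -> {ptws nat -> (R[i])^o}) ;

    seminorm : nat -> X -> R ;
    seminorm_ge0 : forall q x, 0 <= seminorm q x ;
    seminormD : forall q x y,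
      seminorm q (x + y) <= seminorm q x + seminorm q y ;
    seminormZ : forall q (a : R[i]) x,
      seminorm q (a *: x) = modulus a * seminorm q x ;
    seminorm_nondecreasing : forall q x, seminorm q x <= seminorm q.+1 x ;
    seminorm_separating : forall x, (forall q, seminorm q x = 0) -> x = 0 ;
    seminorm_topology : forall A : set X,
      nbhs (0 : X) A <->
      exists q, exists2 e : R, 0 < e & [set x | seminorm q x < e] `<=` A ;
    seminorm_complete : forall u : nat -> X,
      (forall q (e : R), 0 < e -> exists N : nat, forall m n : nat,
         (N <= m)%N -> (N <= n)%N -> seminorm q (u m - u n) < e) ->
      exists l : X, u @ \oo --> l ;

    cmul : X -> X -> X ;
    seq_coord_cmul : forall x y n, seq_coord (cmul x y) n = seq_coord x n * seq_coord y n ;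
    seminorm_cmul : forall q x y,
      seminorm q (cmul x y) <= seminorm q x * seminorm q y
  }.

Record is_Fnorm (R : realType) (X : topologicalLmodType R[i])
    (N : X -> R) : Prop := IsFnorm {
  Fnorm_ge0 : forall u, 0 <= N u ;
  Fnorm_eq0 : forall u, N u = 0 <-> u = 0 ;
  FnormD : forall u v, N (u + v) <= N u + N v ;
  Fnorm_contract : forall (l : R[i]) u, modulus l <= 1 -> N (l *: u) <= N u ;
  Fnorm_scale0 : forall u : X,
    N (l *: u) @[l --> (0 : (R[i])^o)] --> (0 : R) ;
  Fnorm_scale : forall (l : R[i]) u, N (l *: u) <= (modulus l + 1) * N u ;
  Fnorm_topology : forall A : set X,
    nbhs (0 : X) A <-> exists2 e : R, 0 < e & [set u | N u < e] `<=` A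
}.

Definition sigma_compact (T : topologicalType) (A : set T) : Prop :=
  exists2 K : nat -> set T, (forall n, compact (K n)) & A = \bigcup_n K n.

Section Shifts.
Variables (R : realType) (X : topologicalLmodType R[i]).
Variable S : coordwiseFrechetAlgebra X.

Definition delta_seq (k n : nat) : R[i] := (n == k)%:R.

(* Meaningful only when the k-th unit sequence belongs to X. *)
Definition unit_vec (k : nat) : X :=
  xget 0 [set x | seq_coord S x = delta_seq k].

Definition unit_vec_span : set X :=
  [set x | exists n (c : nat -> R[i]), x = \sum_(i < n) c i *: unit_vec i].

Definition unit_vec_span_dense : Prop :=
  (forall k, exists x, seq_coord S x = delta_seq k) /\ dense unit_vec_span.

(* Weights are indexed by n >= 1: the value [w 0] is never used. *)
Definition shift_seq (w : nat -> R) (x : nat -> R[i]) (n : nat) : R[i] :=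
  (w n.+1)%:C * x n.+1.

(* Meaningful only when the shifted sequence belongs to X, as required in
   [admissible]. *)
Definition backward_shift (w : nat -> R) (x : X) : X :=
  xget 0 [set y | seq_coord S y = shift_seq w (seq_coord S x)].

Definition weight (w : nat -> R) : Prop := forall n, (1 <= n)%N -> 0 < w n.

Definition admissible (w : nat -> R) : Prop :=
  (forall x, exists y, seq_coord S y = shift_seq w (seq_coord S x)) /\
  continuous (backward_shift w).

Definition product_shift (d : nat) (w : R -> nat -> R)
    (lam : 'I_d -> R) (v : 'I_d -> X) : 'I_d -> X :=
  fun i => backward_shift (w (lam i)) (v i).

Definition continuous_family (d : nat) (I : set R) (w : R -> nat -> R) : Prop :=
  (forall n, (1 <= n)%N -> {within I, continuous (fun a => w a n)}) /\
  {within [set p : {ptws 'I_d -> R} * {ptws 'I_d -> X} | forall i, I (p.1 i)],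
    continuous (fun p : {ptws 'I_d -> R} * {ptws 'I_d -> X} =>
      (product_shift w p.1 p.2 : {ptws 'I_d -> X}))}.

Definition prod_cmul (d : nat) (u v : 'I_d -> X) : 'I_d -> X :=
  fun i => cmul S (u i) (v i).

End Shifts.

Definition weight_prod (R : realType) (w : nat -> R) (k : nat) : R :=
  \prod_(1 <= i < k.+1) w i.

Definition hypercyclic_vectors (Y : topologicalType) (T : Y -> Y) : set Y :=
  [set x | dense [set iter n T x | n in [set n | (1 <= n)%N]]].

Definition subalgebra (K : fieldType) (Y : lmodType K) (mul : Y -> Y -> Y)
    (A : set Y) : Prop :=
  [/\ A 0,
      forall u v, A u -> A v -> A (u + v),
      forall (a : K) u, A u -> A (a *: u) &
      forall u v, A u -> A v -> A (mul u v)].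

Definition common_hypercyclic_algebra (R : realType)
    (X : topologicalLmodType R[i]) (S : coordwiseFrechetAlgebra X) (d : nat)
    (L : Type) (Lam : set L) (T : L -> ('I_d -> X) -> ('I_d -> X)) : Prop :=
  exists A : set ('I_d -> X),
    [/\ subalgebra (@prod_cmul R X S d) A,
        (exists2 u, A u & u <> 0) &
        A `\ 0 `<=` \bigcap_(l in Lam)
          (@hypercyclic_vectors {ptws 'I_d -> X} (T l))].

(* Main.v *)
Require Import Defs.
From mathcomp Require Import all_boot all_order all_algebra.
From mathcomp Require Import complex.
From mathcomp Require Import all_classical all_reals all_analysis.
From mathcomp Require Import zify ring lra.

(** A Baire category argument produces one [u] such that, for every [m], every
    target [v] and every parameter [q], some iterate of [T_q] maps [u^m] close
    to [v] and the higher powers of [u] close to [0]; every nonzero polynomial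
    in [u] without constant term is then hypercyclic, its lowest power being
    the one that hits.

    Density amounts to perturbing a finitely supported vector by a sum of blocks
    [sum_l (v_l W_a(l) / W_a(l + N))^(1/m) e_(l + N)], one for each pair
    [(N, a)] of a finite net of times and parameters, where
    [W_a(n) = w_1(a) ... w_n(a)].  For the blocks not to disturb each other one
    needs [|a - a'| <= C ((N' - N) / N')^alpha] for [N < N'], one needs the
    parameters to be [N^(-alpha)]-dense, and one needs the sums of
    [(N' - N)^(-beta)] to be small.  Subdivide a cube of dimension [d] into
    [b^d] cubes at each scale, and let the times of distinct cubes of level [s]
    differ by at least [N B^s].  The three constraints hold as soon as
    [B^alpha < b], [b^d < B^beta] and [2 b^d <= B], which is possible because
    [alpha d < beta] and [alpha d < 1]: the sums are geometric, hence small for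
    [N] large whatever the depth, and the depth can be chosen after [N]. *)

Set Implicit Arguments.
Unset Strict Implicit.
Unset Printing Implicit Defensive.

Import Order.TTheory GRing.Theory Num.Theory.
Import numFieldTopology.Exports numFieldNormedType.Exports.

Local Open Scope classical_set_scope.
Local Open Scope ring_scope.
Local Open Scope complex_scope.

(** * Times and parameters *)

(** With [b = 2 ^ q] and [B = 2 ^ p] these are the scale constraints [B ^ alpha < b],
    [b ^ d < B ^ beta] and [2 * b ^ d <= B]. They amount to placing the rational [p / q] between
    [max (d / beta) d] and [1 / alpha], an interval that the hypotheses make nonempty. *)
Lemma scale_exponents (R : realType) (alpha beta : R) (d : nat) :
  0 < alpha -> (0 < d)%N -> alpha * d%:R < 1 -> alpha * d%:R < beta ->
  exists p q : nat, [/\ (0 < q)%N, p%:R * alpha < q%:R,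
    (q * d)%:R < p%:R * beta & (q * d < p)%N].
Proof.
move=> a0 d0 ad1 adb.
have d0R : (0 : R) < d%:R by rewrite ltr0n.
have b0 : 0 < beta by apply: le_lt_trans adb; rewrite mulr_ge0// ltW.
have [r] : exists r : rat, ratr r \in `]Num.max (d%:R / beta) d%:R, alpha^-1[.
  apply: rat_in_itvoo; rewrite gt_max; apply/andP; split.
    by rewrite ltr_pdivrMr// mulrC ltr_pdivlMr// mulrC.
  by rewrite -[ltRHS]mul1r ltr_pdivlMr// mulrC.
rewrite in_itv/= gt_max => /andP[/andP[h1 h2] h3].
have r0 : 0 < ratr r :> R by exact: lt_trans h2.
have rE : ratr r = `|numq r|%:R / `|denq r|%:R :> R.
  have n0 : 0 < numq r by rewrite numq_gt0 -(ltr0q R).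
  by rewrite /ratr !natr_absz (gtr0_norm n0) (gtr0_norm (denq_gt0 r)).
have q0 : (0 : R) < `|denq r|%:R by rewrite ltr0n absz_gt0 gt_eqF// denq_gt0.
exists `|numq r|%N, `|denq r|%N; split.
- by rewrite -(ltr0n R).
- by move: h3; rewrite rE -[ltRHS]mul1r ltr_pdivlMr// mulrAC ltr_pdivrMr// mul1r.
- by move: h1; rewrite rE ltr_pdivrMr// mulrAC ltr_pdivlMr// natrM mulrC.
- by move: h2; rewrite rE ltr_pdivlMr// -(ltr_nat R) natrM mulrC.
Qed.

Lemma natrX_powR (R : realType) (b n : nat) (x : R) :
  (b ^ n)%:R `^ x = (b%:R `^ x) ^+ n :> R.
Proof. by rewrite natrX -powR_mulrn// powRAC powR_mulrn// powR_ge0. Qed.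

(** Used with [a = N ^ beta] and [t = B ^ beta]: the last summand is the contribution of [M]
    children with [M ^ r] points each, all at gaps at least [N * B ^ r]. *)
Lemma geometric_step (R : realType) (M t a : R) (r : nat) : M / t < 1 ->
  M / a / (1 - M / t) * (1 - (M / t) ^+ r.+1) =
  M / a / (1 - M / t) * (1 - (M / t) ^+ r) + M * (M ^+ r * (a * t ^+ r)^-1).
Proof.
move=> theta1; have -> : M * (M ^+ r * (a * t ^+ r)^-1) = M / a * (M / t) ^+ r.
  by rewrite expr_div_n invfM -!mulrA; congr (_ * _); rewrite mulrCA.
set th := M / t in theta1 *; have th0 : 1 - th != 0 by rewrite subr_eq0 gt_eqF.
by rewrite -[X in _ = _ + X * _](divfK th0) exprS; ring.
Qed.

Section GapNet.
Variables (R : realType) (Q : eqType) (dist : Q -> Q -> R).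
Variables (piece : nat -> set Q -> Prop) (diam : nat -> R).
Variables (M B N : nat) (beta : R).
Hypothesis pieceS : forall r A, piece r.+1 A -> exists f : 'I_M -> set Q,
  [/\ forall i, piece r (f i), forall i, f i `<=` A & A `<=` \bigcup_i f i].
Hypothesis piece_dist : forall r A, piece r A ->
  forall x y, A x -> A y -> dist x y <= diam r.
Hypotheses (M_gt0 : (0 < M)%N) (N_gt0 : (0 < N)%N) (leMB : (2 * M <= B)%N).
Hypothesis (beta_gt0 : 0 < beta).

Let theta : R := M%:R / B%:R `^ beta.
Hypothesis theta_lt1 : theta < 1.
Let E : R := M%:R / N%:R `^ beta / (1 - theta).

Let B_gt0 : (0 < B)%N.
Proof. by apply: leq_trans leMB; rewrite muln_gt0. Qed.

Let theta_ge0 : 0 <= theta.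
Proof. by rewrite /theta divr_ge0// powR_ge0. Qed.

(** The times of child [i] lie in a window of length [g = N * B ^ r] starting at [i * (2 * g)], so a
    free stretch of length [g] separates consecutive windows. *)
Lemma offset_gap (r i j u v : nat) :
  (u <= N * B ^ r)%N -> (v <= N * B ^ r)%N ->
  (i * (2 * (N * B ^ r)) + u < j * (2 * (N * B ^ r)) + v)%N -> i != j ->
  (N * B ^ r <= j * (2 * (N * B ^ r)) + v - (i * (2 * (N * B ^ r)) + u))%N.
Proof.
set g := (N * B ^ r)%N => ug vg; case: (ltngtP i j) => //; last first.
  move=> ji; have : (j.+1 * (2 * g) <= i * (2 * g))%N by rewrite leq_mul2r ji orbT.
  rewrite mulSn; lia.
move=> ij; have : (i.+1 * (2 * g) <= j * (2 * g))%N by rewrite leq_mul2r ij orbT.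
rewrite mulSn; lia.
Qed.

Lemma offset_le (i u g : nat) :
  (i < M)%N -> (u <= g)%N -> (i * (2 * g) + u <= g * (2 * M))%N.
Proof.
move=> iM ug; have : (i.+1 * (2 * g) <= M * (2 * g))%N by rewrite leq_mul2r iM orbT.
rewrite mulSn; lia.
Qed.

(* Children of a piece of level [r.+1] are separated by time gaps
   [N * B ^ r]; as [M < B ^ beta], the sums of inverse powers of the gaps are
   geometric in the level, hence bounded independently of the depth. *)
Lemma gap_net (r : nat) (A : set Q) : piece r A ->
  exists L : seq (nat * Q),
  [/\ uniq (map fst L), (size L <= M ^ r)%N,
      forall x : nat * Q, x \in L -> (x.1 <= N * B ^ r)%N /\ A x.2,
      forall a, A a -> exists2 x : nat * Q, x \in L & dist a x.2 <= diam 0 &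
      (forall x y : nat * Q, x \in L -> y \in L -> (x.1 < y.1)%N ->
        exists s, [/\ (s < r)%N, (N * B ^ s <= y.1 - x.1)%N &
                      dist x.2 y.2 <= diam s.+1]) /\
      (forall x : nat * Q, x \in L ->
        \sum_(y <- L | (x.1 < y.1)%N) ((y.1 - x.1)%:R `^ beta)^-1
          <= E * (1 - theta ^+ r))].
Proof.
elim: r A => [|r IH] A pA.
  (* A piece may be empty; its net is then the empty list. *)
  have [[a Aa]|A0] := pselect (exists a, A a).
    exists [:: (0%N, a)]; split => //=.
    - by move=> x; rewrite inE => /eqP ->.
    - by move=> b Ab; exists (0%N, a); rewrite ?inE//; exact: piece_dist pA _ _ Ab Aa.
    - split=> [x y|x]; rewrite !inE; first by move=> /eqP-> /eqP->.
      by move=> /eqP->; rewrite big_cons big_nil ltnn subrr mulr0.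
  exists [::]; split => //= a Aa; exfalso; apply: A0; by exists a.
have [f [pf fA Af]] := pieceS pA.
have /choice[L HL] i := IH _ (pf i).
pose g := (N * B ^ r)%N; pose sh (i : 'I_M) (x : nat * Q) := ((i * (2 * g) + x.1)%N, x.2).
exists [seq sh i x | i <- enum 'I_M, x <- L i].
have Lg i x : x \in L i -> (x.1 <= g)%N by case: (HL i) => _ _ h _ _ /h[].
(* This is where [2 * M <= B] enters: the [M] windows fit below the time bound of the next level. *)
have ME : (g * (2 * M) <= N * B ^ r.+1)%N.
  by rewrite expnSr [leqRHS]mulnA -/g leq_mul2l leMB orbT.
split.
- rewrite map_allpairs.
  rewrite (_ : [seq _ | i <- _, x <- _] =
    [seq (i * (2 * g) + n)%N | i : 'I_M <- enum 'I_M, n : nat <- map fst (L i)]); last first.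
    congr flatten; apply: eq_map => i; rewrite -map_comp; exact: eq_map.
  apply: allpairs_uniq_dep; first exact: enum_uniq.
    by move=> i _; case: (HL i).
  move=> [i u] [j v] /allpairsPdep[i' [u' [_ u'L [-> ->]]]]
    /allpairsPdep[j' [v' [_ v'L [-> ->]]]] /= eq.
  move: u'L v'L => /mapP[x xL u'E] /mapP[y yL v'E].
  have ug := Lg _ _ xL; have vg := Lg _ _ yL; rewrite -u'E -v'E in ug vg.
  have ij : i' = j' :> nat.
    have g0 : (0 < g)%N by rewrite muln_gt0 N_gt0 expn_gt0 B_gt0.
    apply/eqP; apply: contraT; rewrite neq_ltn => /orP[] h.
      have : (i'.+1 * (2 * g) <= j' * (2 * g))%N by rewrite leq_mul2r h orbT.
      rewrite mulSn; lia.
    have : (j'.+1 * (2 * g) <= i' * (2 * g))%N by rewrite leq_mul2r h orbT.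
    rewrite mulSn; lia.
  move/val_inj: ij => ij; subst j'.
  by move/addnI: eq => ->.
- rewrite size_allpairs_dep sumnE big_map expnS.
  rewrite -[X in (_ <= X * _)%N]card_ord -sum_nat_const big_enum/=.
  by apply: leq_sum => i _; case: (HL i).
- move=> _ /allpairsPdep[i [x [_ xL ->]]]/=; split; last first.
    by case: (HL i) => _ _ /(_ _ xL)[_ /fA].
  by apply: leq_trans ME; apply: offset_le => //; exact: Lg xL.
- move=> a /Af[i _ fa]; case: (HL i) => _ _ _ /(_ _ fa)[x xL dx] _.
  exists (sh i x) => //; apply/allpairsPdep; exists i, x; split => //.
  by rewrite mem_enum.
split.
- move=> _ _ /allpairsPdep[i [x [_ xL ->]]] /allpairsPdep[j [y [_ yL ->]]]/= xy.
  have [ij|ij] := eqVneq i j.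
    subst j; rewrite ltn_add2l in xy.
    case: (HL i) => _ _ _ _ [/(_ _ _ xL yL xy)[s [sr gs ds]] _].
    by exists s; rewrite subnDl; split => //; apply: leqW.
  exists r; split => //.
    by apply: offset_gap => //; [exact: Lg xL|exact: Lg yL].
  apply: (piece_dist pA); [case: (HL i)|case: (HL j)] => _ _ h _ _; apply: (fA _).
    by case: (h _ xL) => _; exact.
  by case: (h _ yL) => _; exact.
- move=> _ /allpairsPdep[i [x [_ xL ->]]]/=.
  rewrite big_mkcond big_allpairs_dep/= big_enum/=.
  under eq_bigr do rewrite -big_mkcond/=.
  rewrite (bigD1 i)//=.
  have gE : g%:R `^ beta = N%:R `^ beta * (B%:R `^ beta) ^+ r.
    by rewrite natrM powRM// natrX_powR.
  rewrite /E /theta geometric_step// -/theta -/E -gE.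
  (* Translating a child leaves its time differences unchanged, so the child of [x] contributes the
     inductive bound. Every other child contributes at most [M ^ r] terms, each at most
     [g ^ (- beta)]. *)
  apply: lerD.
    under eq_bigl do rewrite ltn_add2l.
    under eq_bigr do rewrite subnDl.
    by case: (HL i) => _ _ _ _ [_]; exact.
  apply: (@le_trans _ _ (\sum_(j < M) M%:R ^+ r * (g%:R `^ beta)^-1)); last first.
    by rewrite sumr_const card_ord mulr_natl.
  rewrite big_mkcond/=; apply: ler_sum => j _.
  case: ifP => [ji|_]; last by rewrite mulr_ge0 ?exprn_ge0// invr_ge0 powR_ge0.
  apply: (@le_trans _ _ (\sum_(y <- L j) (g%:R `^ beta)^-1)).
    rewrite big_seq_cond [leRHS]big_seq big_mkcond [leRHS]big_mkcond/=.
    apply: ler_sum => y _; case: ifP => [/andP[yL xy]|_].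
      rewrite yL lef_pV2 ?posrE ?powR_gt0// ?ltr0n ?subn_gt0//; last first.
        by rewrite muln_gt0 N_gt0 expn_gt0 B_gt0.
      apply: ge0_ler_powR; rewrite ?nnegrE ?(ltW beta_gt0)// ler_nat.
      by apply: offset_gap => //; [exact: Lg xL|exact: Lg yL|rewrite eq_sym].
    by case: ifP => // _; rewrite invr_ge0 powR_ge0.
  rewrite big_const_seq count_predT iter_addr addr0 -[leLHS]mulr_natl.
  apply: ler_wpM2r; first by rewrite invr_ge0 powR_ge0.
  by rewrite -natrX ler_nat; case: (HL j).
Qed.

End GapNet.

(** * F-norms and coordinates *)

Section ModulusTheory.
Variable R : realType.
Implicit Types z : R[i].

Lemma normC_modulus z : `|z| = (modulus z)%:C.
Proof. by []. Qed.

Lemma modulus_real (r : R) : modulus r%:C = `|r|.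
Proof. by rewrite /modulus /= expr0n/= addr0 sqrtr_sqr. Qed.

Lemma modulus0 : modulus (0 : R[i]) = 0.
Proof. exact: etrans (modulus_real 0) (normr0 _). Qed.

Lemma modulusM z1 z2 : modulus (z1 * z2) = modulus z1 * modulus z2.
Proof. exact: ComplexField.Normc.normcM. Qed.

Lemma modulusX z n : modulus (z ^+ n) = modulus z ^+ n.
Proof.
elim: n => [|n IH]; last by rewrite !exprS modulusM IH.
by rewrite !expr0 (modulus_real 1) normr1.
Qed.

Lemma modulus_ge0 z : 0 <= modulus z.
Proof. by case: z => a b; exact: sqrtr_ge0. Qed.

Lemma modulusN z : modulus (- z) = modulus z.
Proof. by case: z => a b; rewrite /modulus /= !sqrrN. Qed.

End ModulusTheory.

Section Frechet.
Variables (R : realType) (X : topologicalLmodType R[i]).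
Variables (S : coordwiseFrechetAlgebra X) (Fnorm : X -> R).
Hypotheses (hFnorm : is_Fnorm Fnorm) (hspan : unit_vec_span_dense S).
Local Notation co := (seq_coord S).
Local Notation e_ := (unit_vec S).

Lemma coordD x y n : co (x + y) n = co x n + co y n.
Proof. by rewrite -[x]scale1r seq_coord_linear mul1r scale1r. Qed.

Lemma coord0 n : co 0 n = 0.
Proof. by apply: (addrI (co 0 n)); rewrite -coordD !addr0. Qed.

Lemma coordZ a x n : co (a *: x) n = a * co x n.
Proof. by rewrite -[a *: x]addr0 seq_coord_linear coord0 addr0. Qed.

Lemma coordN x n : co (- x) n = - co x n.
Proof. by rewrite -scaleN1r coordZ mulN1r. Qed.

Lemma coord_sum (J : Type) (r : seq J) (P : pred J) (f : J -> X) n :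
  co (\sum_(j <- r | P j) f j) n = \sum_(j <- r | P j) co (f j) n.
Proof.
by elim/big_rec2: _ => [|j x y _ <-]; rewrite ?coord0// coordD.
Qed.

Lemma coord_ext x y : (forall n, co x n = co y n) -> x = y.
Proof. by move=> h; apply: (@seq_coord_inj _ _ S); apply/funext. Qed.

Lemma coord_unit k n : co (e_ k) n = (n == k)%:R.
Proof.
have [x hx] := hspan.1 k.
by rewrite /unit_vec; case: xgetP => [y -> /= ->//|/(_ x)]; rewrite /= hx.
Qed.

Lemma Fnorm0 : Fnorm 0 = 0.
Proof. exact/(Fnorm_eq0 hFnorm). Qed.

Lemma FnormN u : Fnorm (- u) = Fnorm u.
Proof.
have h v : Fnorm (- v) <= Fnorm v.
  rewrite -scaleN1r; apply: (Fnorm_contract hFnorm).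
  by rewrite modulusN (modulus_real 1) normr1.
by apply/eqP; rewrite eq_le h -{1}[u]opprK h.
Qed.

Lemma FnormB u v : Fnorm (u - v) = Fnorm (v - u).
Proof. by rewrite -FnormN opprB. Qed.

Lemma Fnorm_sum (J : Type) (r : seq J) (P : pred J) (f : J -> X) :
  Fnorm (\sum_(j <- r | P j) f j) <= \sum_(j <- r | P j) Fnorm (f j).
Proof.
elim/big_rec2: _ => [|j x y _ h]; first by rewrite Fnorm0.
by apply: (le_trans (FnormD hFnorm _ _)); rewrite lerD2l.
Qed.

Lemma Fnorm_scale_le (D : R) (l : R[i]) u :
  modulus l <= D -> Fnorm (l *: u) <= (D + 1) * Fnorm u.
Proof.
move=> h; apply: (le_trans (Fnorm_scale hFnorm _ _)).
by rewrite ler_wpM2r ?lerD2r// (Fnorm_ge0 hFnorm).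
Qed.

Lemma Fnorm_scale_small u (e : R) : 0 < e ->
  exists2 dl : R, 0 < dl & forall l, modulus l <= dl -> Fnorm (l *: u) < e.
Proof.
move=> e0; have := Fnorm_scale0 hFnorm u => /cvgrPdist_lt/(_ _ e0).
case/nbhs_ballP => dl /= dl0 H.
have [dE dr] : dl = (complex.Re dl)%:C /\ 0 < complex.Re dl.
  by move: dl0; clear; case: dl => a b; rewrite ltcE/= => /andP[/eqP -> ->].
exists (complex.Re dl / 2); first by rewrite divr_gt0.
move=> l hl; have : ball (0 : (R[i])^o) dl l.
  rewrite -ball_normE /= sub0r normrN normC_modulus dE ltcR.
  by apply: le_lt_trans hl _; rewrite ltr_pdivrMr// ltr_pMr// ltr1n.
by move=> /H /=; rewrite sub0r normrN ger0_norm// (Fnorm_ge0 hFnorm).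
Qed.

Lemma nbhs_Fnorm (x : X) (A : set X) :
  nbhs x A <-> exists2 e : R, 0 < e & forall y, Fnorm (y - x) < e -> A y.
Proof.
split=> [xA|[e e0 eA]].
  have : nbhs (0 : X) ((fun z => z + x) @^-1` A).
    have /(_ A) := @add_continuous X (0 : X, x); rewrite /= add0r => /(_ xA) [[U V] /=[U0 Vx] UV].
    apply: filterS U0 => z Uz /=; apply: (UV (z, x)); split => //=.
    exact: nbhs_singleton.
  case/(Fnorm_topology hFnorm) => e e0 eA; exists e => // y /eA /=.
  by rewrite subrK.
have : nbhs (0 : X) [set u | Fnorm u < e] by apply/(Fnorm_topology hFnorm); exists e.
move=> h0.
have /(_ _) := @add_continuous X (x, - x); rewrite /= subrr => /(_ _ h0) [[U V] /=[Ux Vx] UV].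
apply: filterS Ux => z Uz; apply: eA; apply: (UV (z, - x)); split => //=.
exact: nbhs_singleton.
Qed.

Lemma seminorm_small q (e : R) : 0 < e ->
  exists2 dl : R, 0 < dl & forall u, Fnorm u < dl -> seminorm S q u < e.
Proof.
move=> e0; have : nbhs (0 : X) [set u | seminorm S q u < e].
  by apply/(seminorm_topology S); exists q, e.
by case/(Fnorm_topology hFnorm) => dl d0 h; exists dl => // u /h.
Qed.

Lemma Fnorm_small_seminorm (e : R) : 0 < e ->
  exists q, exists2 dl : R, 0 < dl & forall u, seminorm S q u < dl -> Fnorm u < e.
Proof.
move=> e0; have : nbhs (0 : X) [set u | Fnorm u < e].
  by apply/(Fnorm_topology hFnorm); exists e.
by case/(seminorm_topology S) => q [dl d0 h]; exists q, dl => // u /h.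
Qed.

(** The F-norm and the seminorms define the same neighbourhoods of [0], hence the same Cauchy
    sequences. *)
Lemma Fnorm_complete (u : nat -> X) :
  (forall e : R, 0 < e -> exists n0 : nat, forall m n : nat,
     (n0 <= m)%N -> (n0 <= n)%N -> Fnorm (u m - u n) < e) ->
  exists l, forall e : R, 0 < e ->
    exists n0 : nat, forall n, (n0 <= n)%N -> Fnorm (u n - l) < e.
Proof.
move=> h; have [l ul] : exists l : X, u @ \oo --> l.
  apply: (seminorm_complete (c := S)) => q e e0.
  have [dl d0 hd] := seminorm_small q e0.
  by have [n0 hn] := h _ d0; exists n0 => m n m0 n1; apply: hd; exact: hn.
exists l => e e0; have : nbhs l [set y | Fnorm (y - l) < e].
  by apply/nbhs_Fnorm; exists e.
by move=> /ul [n0 _ hn]; exists n0 => n n0n; exact: hn.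
Qed.

Lemma cmul_continuous x y (e : R) : 0 < e ->
  exists2 dl : R, 0 < dl & forall x' y', Fnorm (x' - x) < dl ->
    Fnorm (y' - y) < dl -> Fnorm (cmul S x' y' - cmul S x y) < e.
Proof.
move=> e0; have [q [dl d0 hd]] := Fnorm_small_seminorm e0.
pose D := 1 + seminorm S q x + seminorm S q y.
have D1 : 1 <= D by rewrite /D -addrA lerDl addr_ge0// seminorm_ge0.
have D0 : 0 < D by exact: lt_le_trans D1.
(* If both increments have seminorm below [t <= 1], the three terms of the expansion add up to less
   than [t * D <= dl]. *)
pose t := Num.min 1 (dl / D).
have t0 : 0 < t by rewrite lt_min ltr01 divr_gt0.
have [dl' d0' hd'] := seminorm_small q t0.
exists dl' => // x' y' /hd' hx /hd' hy; apply: hd.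
have -> : cmul S x' y' - cmul S x y =
    cmul S (x' - x) (y' - y) + (cmul S x (y' - y) + cmul S (x' - x) y).
  apply: coord_ext => n; rewrite !coordD !coordN !seq_coord_cmul !coordD !coordN.
  ring.
set a := seminorm S q (x' - x) in hx; set b := seminorm S q (y' - y) in hy.
have h1 : seminorm S q (cmul S (x' - x) (y' - y)) <= a * b by exact: seminorm_cmul.
have h2 : seminorm S q (cmul S x (y' - y)) <= seminorm S q x * b by exact: seminorm_cmul.
have h3 : seminorm S q (cmul S (x' - x) y) <= a * seminorm S q y by exact: seminorm_cmul.
have a0 : 0 <= a by exact: seminorm_ge0.
have b0 : 0 <= b by exact: seminorm_ge0.
have x0 : 0 <= seminorm S q x by exact: seminorm_ge0.
have y0 : 0 <= seminorm S q y by exact: seminorm_ge0.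
have t1 : t <= 1 by rewrite ge_min lexx.
have tD : t * D <= dl by rewrite -ler_pdivlMr// ge_min lexx orbT.
apply: (le_lt_trans (seminormD _ _ _ _)).
apply: (le_lt_trans (lerD h1 (seminormD _ _ _ _))).
apply: (le_lt_trans (lerD (lexx _) (lerD h2 h3))).
apply: lt_le_trans tD.
have h4 : a * b < t by apply: (le_lt_trans _ hx); rewrite ler_piMr// ltW// (lt_le_trans hy).
have h5 : seminorm S q x * b <= t * seminorm S q x by rewrite mulrC ler_wpM2r// ltW.
have h6 : a * seminorm S q y <= t * seminorm S q y by rewrite ler_wpM2r// ltW.
rewrite /D; lra.
Qed.

(** The product need not have a unit, so powers start at [u]; the exponent [0] also yields [u]. *)
Definition upow (u : X) (i : nat) : X := iter i.-1 (cmul S u) u.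

Lemma coord_upow u i n : (0 < i)%N -> co (upow u i) n = co u n ^+ i.
Proof.
case: i => // i _; rewrite /upow/=.
by elim: i => [|i IH] /=; rewrite ?expr1// seq_coord_cmul IH -exprS.
Qed.

Lemma upow_continuous u i (e : R) : 0 < e ->
  exists2 dl : R, 0 < dl &
    forall u', Fnorm (u' - u) < dl -> Fnorm (upow u' i - upow u i) < e.
Proof.
rewrite /upow; elim: i.-1 e => [|j IH] e e0 /=; first by exists e.
have [d1 d10 h1] := cmul_continuous u (iter j (cmul S u) u) e0.
have [d2 d20 h2] := IH _ d10.
exists (Num.min d1 d2); first by rewrite lt_min d10.
by move=> u'; rewrite lt_min => /andP[hu1 /h2 hu2]; exact: h1.
Qed.

(** In a field, pairwise vanishing products leave at most one nonzero summand. *)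
Lemma sum_expr_disjoint (J : eqType) (r : seq J) (f : J -> R[i]) i : (0 < i)%N ->
  uniq r -> {in r &, forall s t, s != t -> f s * f t = 0} ->
  (\sum_(j <- r) f j) ^+ i = \sum_(j <- r) f j ^+ i.
Proof.
move=> i0; elim: r => [|a r IH] /=; first by rewrite !big_nil expr0n; case: i i0.
move=> /andP[ar ur] h; rewrite !big_cons.
have [fa0|fa0] := eqVneq (f a) 0.
  rewrite fa0 expr0n (gtn_eqF i0) !add0r IH// => s t sr tr st.
  by apply: h => //; rewrite inE ?sr ?tr orbT.
have hz j : j \in r -> f j = 0.
  move=> jr; have : f a * f j = 0.
    apply: h; rewrite ?mem_head ?inE ?jr ?orbT//.
    by apply: contraNneq ar => ->.
  by move/eqP; rewrite mulf_eq0 (negbTE fa0)/= => /eqP.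
rewrite !big1_seq ?addr0// => j /andP[_ /hz ->]//.
by rewrite expr0n (gtn_eqF i0).
Qed.

End Frechet.

(** * Iterates of weighted shifts *)

Lemma gap_inj (p a b u v : nat) : ((a < b)%N -> (p <= b - a)%N) ->
  ((b < a)%N -> (p <= a - b)%N) -> (u < p)%N -> (v < p)%N ->
  (u + a = v + b)%N -> a = b /\ u = v.
Proof. lia. Qed.

Lemma uniq_map_inj (T1 T2 : eqType) (f : T1 -> T2) (s : seq T1) :
  uniq (map f s) -> {in s &, injective f}.
Proof.
move=> us x x' xs x's fxx.
move: us => /(uniqP (f x)); rewrite size_map => /(_ (index x s) (index x' s)).
rewrite !inE !index_mem xs x's => /(_ erefl erefl).
rewrite !(nth_map x) ?index_mem// !nth_index// => /(_ fxx) hi.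
by rewrite -[x](nth_index x xs) hi nth_index.
Qed.

Lemma weight_prod0 (R : realType) (w : nat -> R) : weight_prod w 0 = 1.
Proof. by rewrite /weight_prod big_geq. Qed.

Lemma weight_prodS (R : realType) (w : nat -> R) n :
  weight_prod w n.+1 = weight_prod w n * w n.+1.
Proof. by rewrite /weight_prod big_nat_recr. Qed.

Lemma weight_prod_gt0 (R : realType) (w : nat -> R) n :
  weight w -> 0 < weight_prod w n.
Proof.
by move=> hw; elim: n => [|n IH]; rewrite ?weight_prod0// weight_prodS mulr_gt0// hw.
Qed.

Lemma ln_weight_prod (R : realType) (w : nat -> R) n : weight w ->
  ln (weight_prod w n) = \sum_(1 <= i < n.+1) ln (w i).
Proof.
move=> hw; elim: n => [|n IH]; first by rewrite weight_prod0 ln1 big_geq.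
by rewrite weight_prodS lnM ?posrE ?weight_prod_gt0 ?hw// IH [RHS]big_nat_recr.
Qed.

Section Shift.
Variables (R : realType) (X : topologicalLmodType R[i]).
Variables (S : coordwiseFrechetAlgebra X) (w : nat -> R).
Hypotheses (hw : weight w) (hadm : admissible S w).
Local Notation co := (seq_coord S).
Local Notation W := (weight_prod w).
Local Notation T := (backward_shift S w).

Lemma coord_shift x n : co (T x) n = (w n.+1)%:C * co x n.+1.
Proof.
have [y hy] := hadm.1 x.
by rewrite /backward_shift; case: xgetP => [z -> /= ->//|/(_ y)].
Qed.

Lemma coord_iter_shift N x n :
  co (iter N T x) n = (W (n + N) / W n)%:C * co x (n + N)%N.
Proof.
elim: N n => [|N IH] n /=.
  by rewrite addn0 divff ?mul1r// gt_eqF// weight_prod_gt0.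
rewrite coord_shift IH mulrA -rmorphM/= addSnnS; congr (_%:C * _).
have hn := weight_prod_gt0 n hw; have hwn := hw (ltn0Sn n).
by rewrite weight_prodS invfM; field; rewrite !gt_eqF.
Qed.

Lemma iter_shiftZ N a x : iter N T (a *: x) = a *: iter N T x.
Proof.
by apply: (@coord_ext _ _ S) => n; rewrite !(coord_iter_shift, coordZ) mulrCA.
Qed.

Lemma iter_shift_sum N (J : Type) (r : seq J) (P : pred J) (f : J -> X) :
  iter N T (\sum_(j <- r | P j) f j) = \sum_(j <- r | P j) iter N T (f j).
Proof.
apply: (@coord_ext _ _ S) => n; rewrite coord_iter_shift !coord_sum mulr_sumr.
by apply: eq_bigr => j _; rewrite coord_iter_shift.
Qed.

End Shift.

Section Block.
Variables (R : realType) (X : topologicalLmodType R[i]).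
Variables (S : coordwiseFrechetAlgebra X).
Hypothesis (hspan : unit_vec_span_dense S).
Variables (w : R -> nat -> R) (m p : nat).
Hypothesis m_gt0 : (0 < m)%N.
Local Notation co := (seq_coord S).
Local Notation e_ := (unit_vec S).
Local Notation W a := (weight_prod (w a)).
Local Notation T a := (backward_shift S (w a)).
Implicit Types (y : nat -> R[i]) (L : seq (nat * R)) (x k : nat * R).

(** Since [T a ^ n] multiplies [e_(l + n)] by [W a (l + n) / W a l] while moving it to [e_l], this
    is the coefficient whose [m]-th power cancels that factor. *)
Definition root_ratio (a : R) (l n : nat) : R :=
  (W a l / W a (l + n)%N) `^ (m%:R^-1).

(* [T a ^ n] maps the m-th power of the part of [block y L] coming from
   [(n, a)] to the vector with coordinates [y l ^+ m], [l < p]. *)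
Definition block y L : X := \sum_(x <- L) \sum_(l < p)
  (y l * (root_ratio x.2 l x.1)%:C) *: e_ (l + x.1)%N.

Lemma root_ratio_ge0 a l n : 0 <= root_ratio a l n.
Proof. exact: powR_ge0. Qed.

Lemma root_ratioX a l n : weight (w a) ->
  root_ratio a l n ^+ m = W a l / W a (l + n)%N.
Proof.
move=> ha; rewrite -powR_mulrn ?root_ratio_ge0// /root_ratio -powRrM.
have m0 : m%:R != 0 :> R by rewrite pnatr_eq0 -lt0n.
rewrite mulVf// powRr1//.
by apply: divr_ge0; apply: ltW; exact: weight_prod_gt0.
Qed.

(** Times at least [p] apart give the unit vectors of the block distinct indices, so the power is
    taken term by term. *)
Lemma coord_block_upow y L u0 i n : (0 < i)%N ->
  uniq (map fst L) ->
  (forall x x', x \in L -> x' \in L -> (x.1 < x'.1)%N -> (p <= x'.1 - x.1)%N) ->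
  co u0 n = 0 ->
  co (upow S (u0 + block y L) i) n = \sum_(x <- L) \sum_(l < p)
    (y l * (root_ratio x.2 l x.1)%:C) ^+ i * (n == l + x.1)%N%:R.
Proof.
move=> i0 uL gap u00; rewrite coord_upow// coordD u00 add0r.
pose f (t : (nat * R) * 'I_p) :=
  (y t.2 * (root_ratio t.1.2 t.2 t.1.1)%:C) * (n == t.2 + t.1.1)%N%:R.
pose Ls := [seq (x, l) | x <- L, l <- enum 'I_p].
have uL' : uniq L by exact: map_uniq uL.
have -> : co (block y L) n = \sum_(t <- Ls) f t.
  rewrite big_allpairs_dep coord_sum; apply: eq_bigr => x _.
  rewrite big_enum coord_sum; apply: eq_bigr => l _.
  by rewrite coordZ coord_unit.
rewrite sum_expr_disjoint//.
- rewrite big_allpairs_dep; apply: eq_bigr => x _.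
  rewrite big_enum; apply: eq_bigr => l _.
  rewrite /f exprMn; congr (_ * _).
  by case: eqP => _; rewrite ?expr1n// expr0n (gtn_eqF i0).
- by apply: allpairs_uniq => //; [exact: enum_uniq|move=> [? ?] [? ?] _ _ [-> ->]].
- move=> _ _ /allpairsP[[x l] [/= xL _ ->]] /allpairsP[[x' l'] [/= xL' _ ->]] ne.
  rewrite /f/=; case: eqP => [nE|_]; last by rewrite mulr0 mul0r.
  case: eqP => [nE'|_]; last by rewrite !mulr0.
  exfalso; have [xx ll] : x.1 = x'.1 /\ l = l' :> nat.
    apply: (@gap_inj p) (ltn_ord l) (ltn_ord l') _ => //; last by rewrite -nE.
      exact: gap.
    exact: gap.
  by move/negP: ne; apply; rewrite (uniq_map_inj uL xL xL' xx) (val_inj ll).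
Qed.

(** Iterating [k.1] times annihilates [u0] and the earlier pieces, brings the piece of [k] onto the
    first [p] coordinates and leaves the later pieces as an error term. *)
Lemma iter_shift_block y L u0 i n1 a k :
  weight (w a) -> admissible S (w a) -> (0 < i)%N ->
  uniq (map fst L) ->
  (forall x x', x \in L -> x' \in L -> (x.1 < x'.1)%N -> (p <= x'.1 - x.1)%N) ->
  (forall n, (n1 <= n)%N -> co u0 n = 0) -> k \in L -> (n1 <= k.1)%N ->
  iter k.1 (T a) (upow S (u0 + block y L) i) =
  \sum_(l < p) ((y l * (root_ratio k.2 l k.1)%:C) ^+ i
      * (W a (l + k.1)%N / W a l)%:C) *: e_ l +
  \sum_(x <- L | (k.1 < x.1)%N) \sum_(l < p)
    ((y l * (root_ratio x.2 l x.1)%:C) ^+ i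
      * (W a (l + x.1)%N / W a (l + x.1 - k.1)%N)%:C) *: e_ (l + x.1 - k.1)%N.
Proof.
move=> ha hadm i0 uL gap u00 kL n1k; apply: (@coord_ext _ _ S) => n.
rewrite coord_iter_shift// coord_block_upow//; last first.
  by apply: u00; rewrite (leq_trans n1k) ?leq_addl.
rewrite coordD mulr_sumr (bigD1_seq k)//=; last exact: map_uniq uL.
congr (_ + _).
  rewrite coord_sum mulr_sumr; apply: eq_bigr => l _.
  rewrite coordZ coord_unit// eqn_add2r.
  have [->|_] := eqVneq n l; last by rewrite !mulr0.
  by rewrite !mulr1 mulrC.
rewrite coord_sum big_seq_cond [RHS]big_seq_cond [LHS]big_mkcond [RHS]big_mkcond/=.
apply: eq_bigr => x _; have [xL|//] := boolP (x \in L); rewrite /=.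
have [->|xk] := eqVneq x k; first by rewrite ltnn.
have [kx|xk'] := ltnP k.1 x.1.
  rewrite coord_sum mulr_sumr; apply: eq_bigr => l _.
  rewrite coordZ coord_unit//.
  have -> : (n + k.1 == l + x.1)%N = (n == l + x.1 - k.1)%N by lia.
  case: eqP => [->|_]; last by rewrite !mulr0.
  by rewrite !mulr1 mulrC subnK//; lia.
(* An earlier piece lives on indices below [x.1 + p <= k.1], which the shift pushes out. *)
have {}xk' : (x.1 < k.1)%N.
  rewrite ltn_neqAle xk' andbT; apply: contra xk => /eqP xx.
  exact/eqP/(uniq_map_inj uL).
have := gap _ _ xL kL xk' => hg.
rewrite big1 ?mulr0// => l _; case: eqP => [|_]; last by rewrite mulr0.
by have := ltn_ord l; lia.
Qed.

End Block.

(** * Estimates on the blocks *)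

Lemma expR_near1 (R : realType) (e : R) : 0 < e ->
  exists2 d : R, 0 < d & forall t, `|t| <= d -> `|expR t - 1| <= e.
Proof.
move=> e0; have := @continuous_expR R 0; rewrite /continuous_at expR0.
move=> /cvgrPdist_le/(_ _ e0)/nbhs_ballP[d /= d0 hd].
exists (d / 2); first by rewrite divr_gt0.
move=> t td; rewrite distrC; apply: hd.
rewrite -ball_normE /= sub0r normrN (le_lt_trans td)//.
by rewrite ltr_pdivrMr// ltr_pMr// ltr1n.
Qed.

Section Estimates.
Variables (R : realType) (X : topologicalLmodType R[i]).
Variables (S : coordwiseFrechetAlgebra X) (Fnorm : X -> R).
Hypotheses (hFnorm : is_Fnorm Fnorm) (hspan : unit_vec_span_dense S).
Variables (w : R -> nat -> R) (m p : nat) (I0 : set R).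
Hypothesis m_gt0 : (0 < m)%N.
Hypothesis weightI : forall a, I0 a -> weight (w a).
Hypothesis admI : forall a, I0 a -> admissible S (w a).
Local Notation co := (seq_coord S).
Local Notation e_ := (unit_vec S).
Local Notation W a := (weight_prod (w a)).
Local Notation T a := (backward_shift S (w a)).
Local Notation rr := (root_ratio w m).
Local Notation blk := (block S w m p).

Variables (C1 C2 alpha beta M0 kappa : R) (F : nat -> R) (N0 : nat).
Hypotheses (alpha_gt0 : 0 < alpha) (beta_gt0 : 0 < beta).
Hypotheses (C1_gt0 : 0 < C1) (M0_gt0 : 0 < M0) (N0_gt0 : (0 < N0)%N).
Hypothesis F_ge0 : forall n, (0 < n)%N -> 0 <= F n.
Hypothesis F_le : forall n, (0 < n)%N -> F n <= C1 * n%:R `^ alpha.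
Hypothesis lipW : forall n a b, (N0 <= n)%N -> I0 a -> I0 b ->
  `|ln (W a n) - ln (W b n)| <= F n * `|a - b|.
Hypothesis infW : forall A : R, exists k0, forall k a, (k0 <= k)%N -> I0 a ->
  A <= W a k.
Hypothesis decay_exp : forall n k a, (N0 <= n)%N -> (N0 <= k)%N -> I0 a ->
  Fnorm ((expR (C2 * (F (n + k)%N / (n + k)%:R `^ alpha) * k%:R `^ alpha)
    / W a k)%:C *: e_ k) <= M0 / k%:R `^ beta.
Hypothesis decay_root : forall k a, (N0 <= k)%N -> I0 a ->
  Fnorm ((1 / W a k `^ (1 / m%:R))%:C *: e_ k) <= M0 / k%:R `^ beta.
Hypothesis kappa_ge1 : 1 <= kappa.
Hypothesis W_le_kappa : forall l a, (l < p)%N -> I0 a -> W a l <= kappa.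
Hypothesis W_unif : forall e : R, 0 < e -> exists2 dl : R, 0 < dl &
  forall l a b, (l < p)%N -> I0 a -> I0 b -> `|a - b| <= dl ->
  `|W b l / W a l - 1| <= e.

Let W_gt0 a n : I0 a -> 0 < W a n.
Proof. by move=> Ia; exact/weight_prod_gt0/weightI. Qed.

Let kappa_gt0 : 0 < kappa. Proof. exact: lt_le_trans kappa_ge1. Qed.

Lemma unit_vec_small (e : R) : 0 < e -> exists2 dl : R, 0 < dl &
  forall l z, (l < p)%N -> modulus z <= dl -> Fnorm (z *: e_ l) < e.
Proof.
move=> e0; elim: p => [|q [d d0 IH]]; first by exists 1.
have [d' d0' h] := Fnorm_scale_small hFnorm (e_ q) e0.
exists (Num.min d d'); first by rewrite lt_min d0.
move=> l z; rewrite ltnS leq_eqVlt le_min => /orP[/eqP ->|lq] /andP[zd zd'].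
  exact: h.
exact: IH.
Qed.

Lemma inv_powR_le (a b : nat) : (0 < a)%N -> (a <= b)%N ->
  (b%:R `^ beta)^-1 <= (a%:R `^ beta)^-1 :> R.
Proof.
move=> a0 ab; rewrite lef_pV2 ?posrE ?powR_gt0 ?ltr0n ?(leq_trans a0 ab)//.
by apply: ge0_ler_powR; rewrite ?nnegrE ?(ltW beta_gt0)// ler_nat.
Qed.

Lemma W_ratio a b n : I0 a -> I0 b ->
  W a n / W b n = expR (ln (W a n) - ln (W b n)).
Proof.
by move=> Ia Ib; rewrite expRB !lnK ?posrE ?W_gt0.
Qed.

Lemma ratio_near1 (e : R) : 0 < e -> exists2 dl : R, 0 < dl &
  forall l n a b, (l < p)%N -> (N0 <= n)%N -> I0 a -> I0 b ->
    `|a - b| <= dl -> (n + p)%:R `^ alpha * `|a - b| <= dl ->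
    `|(W b l / W b (l + n)%N) * (W a (l + n)%N / W a l) - 1| <= e.
Proof.
move=> e0; pose e1 := Num.min 1 (e / 3).
have e10 : 0 < e1 by rewrite lt_min ltr01 divr_gt0.
have [d d0 hd] := expR_near1 e10; have [d' d0' hd'] := W_unif e10.
exists (Num.min d' (d / C1)); first by rewrite lt_min d0' divr_gt0.
move=> l n a b lp n0 Ia Ib; rewrite !le_min => /andP[ab _] /andP[_ nab].
(* The first factor involves only indices below [p] and is near [1] by uniform continuity. The
   second is the exponential of a difference of logarithms, which the Lipschitz bound with
   [F n <= C1 * n ^ alpha] makes small. *)
have -> : (W b l / W b (l + n)%N) * (W a (l + n)%N / W a l) =
   (W b l / W a l) * (W a (l + n)%N / W b (l + n)%N) by ring.
rewrite (W_ratio (l + n) Ia Ib); set t := ln _ - ln _.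
have l0n : (0 < l + n)%N by rewrite addn_gt0 (leq_trans N0_gt0 n0) orbT.
have ht : `|expR t - 1| <= e1.
  have n0' : (N0 <= l + n)%N by rewrite (leq_trans n0) ?leq_addl.
  apply: hd; apply: (le_trans (lipW n0' Ia Ib)).
  move: nab; rewrite ler_pdivlMr// mulrC => /(le_trans _); apply.
  rewrite mulrA ler_wpM2r//; apply: (le_trans (F_le l0n)).
  rewrite ler_pM2l//; apply: ge0_ler_powR; rewrite ?nnegrE ?(ltW alpha_gt0)//.
  by rewrite ler_nat addnC leq_add2l ltnW.
have hx := hd' _ _ _ lp Ia Ib ab.
set x := W b l / W a l in hx *; set y := expR t in ht *.
have -> : x * y - 1 = (x - 1) * (y - 1) + (x - 1) + (y - 1) by ring.
apply: (le_trans (ler_normD _ _)); apply: (le_trans (lerD (ler_normD _ _) (lexx _))).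
rewrite normrM.
have h1 : `|x - 1| * `|y - 1| <= e1.
  rewrite -[leRHS]mul1r; apply: ler_pM => //.
  by apply: (le_trans hx); rewrite ge_min lexx.
have : e1 <= e / 3 by rewrite ge_min lexx orbT.
lra.
Qed.

(** For a power [i > m], the diagonal term keeps the uncancelled factor [rr ^ (i - m)]; this makes
    it small. *)
Lemma root_ratio_small (t : R) : 0 < t -> exists N1, forall l n a,
  (l < p)%N -> (N1 <= n)%N -> I0 a -> rr a l n <= t.
Proof.
move=> t0; have [k0 hk] := infW (kappa / t ^+ m).
exists k0 => l n a lp kn Ia.
rewrite -(@ler_pXn2r _ _ m_gt0) ?nnegrE ?root_ratio_ge0 ?(ltW t0)//.
rewrite root_ratioX; [|by []|exact: weightI].
rewrite ler_pdivrMr ?W_gt0// mulrC -ler_pdivrMr ?exprn_gt0//.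
have kln : (k0 <= l + n)%N by rewrite (leq_trans kn) ?leq_addl.
apply: le_trans (hk _ _ kln Ia).
by rewrite ler_pM2r ?invr_gt0 ?exprn_gt0// W_le_kappa.
Qed.

(** The [m]-th root of [1 / W a (l + n)] is what [decay_root] controls. An F-norm is not
    homogeneous, so a scalar of modulus at most [D] costs a factor [D + 1]. *)
Lemma block_term_le (Y : R) (y : R[i]) l n a : 0 <= Y -> modulus y <= Y ->
  (l < p)%N -> (N0 <= n)%N -> I0 a ->
  Fnorm ((y * (rr a l n)%:C) *: e_ (l + n)%N)
    <= (Y * kappa + 1) * (M0 * (n%:R `^ beta)^-1).
Proof.
move=> Y0 yY lp n0 Ia.
have -> : rr a l n = W a l `^ (1 / m%:R) * (1 / W a (l + n)%N `^ (1 / m%:R)).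
  rewrite /root_ratio !mul1r powRM ?invr_ge0 ?ltW ?W_gt0//; congr (_ * _).
  rewrite -[X in X `^ _ = _]powR_inv1 ?(ltW (W_gt0 _ Ia))//.
  by rewrite powRAC powR_inv1// powR_ge0.
rewrite rmorphM/= [y * _]mulrA -scalerA.
apply: (@le_trans _ _ ((Y * kappa + 1) * (M0 / (l + n)%:R `^ beta))); last first.
  rewrite ler_wpM2l ?addr_ge0 ?mulr_ge0// ?(ltW kappa_gt0)//.
  rewrite ler_pM2l// inv_powR_le ?leq_addl//; exact: leq_trans n0.
apply: (le_trans (Fnorm_scale_le hFnorm _ (_ : _ <= Y * kappa))).
  rewrite modulusM modulus_real ger0_norm ?powR_ge0//.
  apply: ler_pM; rewrite ?modulus_ge0 ?powR_ge0//.
  apply: (@le_trans _ _ (kappa `^ (1 / m%:R))).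
    by apply: ge0_ler_powR; rewrite ?nnegrE ?divr_ge0 ?(ltW kappa_gt0) ?(ltW (W_gt0 _ Ia)) ?W_le_kappa.
  by apply: ler1_powR => //; rewrite ler_pdivrMr ?ltr0n// mul1r ler1n.
apply: ler_wpM2l; first by rewrite addr_ge0 ?mulr_ge0 ?(ltW kappa_gt0).
by apply: decay_root => //; rewrite (leq_trans n0) ?leq_addl.
Qed.

(** The coefficient was built with [W b] but the iterate multiplies by [W a]. The bound on [|a - b|]
    keeps this mismatch below the exponential that [decay_exp] allows. *)
Lemma offdiag_term_le (Y : R) (s i l nk nj : nat) (y : R[i]) a b :
  1 <= Y -> modulus y <= Y -> (m <= i <= s)%N -> (l < p)%N ->
  I0 a -> I0 b -> (N0 <= nk)%N -> (nk < nj)%N -> (N0 <= nj - nk)%N ->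
  rr b l nj <= 1 ->
  `|a - b| <= C2 * ((l + nj - nk)%:R `^ alpha / (l + nj)%:R `^ alpha) ->
  Fnorm (((y * (rr b l nj)%:C) ^+ i
    * (W a (l + nj)%N / W a (l + nj - nk)%N)%:C) *: e_ (l + nj - nk)%N)
  <= (Y ^+ s * kappa + 1) * (M0 * ((nj - nk)%:R `^ beta)^-1).
Proof.
move=> Y1 yY /andP[mi is_] lp Ia Ib n0 nkj n0' r1 ab.
set k' := (l + nj - nk)%N; have nkl : (nk <= l + nj)%N by rewrite (leq_trans (ltnW nkj)) ?leq_addl.
have kE : (nk + k' = l + nj)%N by rewrite subnKC.
have lek' : (nj - nk <= k')%N by rewrite leq_sub2r ?leq_addl.
have k'0 : (N0 <= k')%N by exact: leq_trans lek'.
have Y0 : 0 <= Y by exact: le_trans Y1.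
(* The exponent of [decay_exp] at [n = nk] and [k = k'], for which [n + k = l + nj]. *)
pose E := C2 * (F (nk + k')%N / (nk + k')%:R `^ alpha) * k'%:R `^ alpha.
pose t := ln (W a (l + nj)%N) - ln (W b (l + nj)%N).
have tE : t <= E.
  have n0'' : (N0 <= l + nj)%N by exact: leq_trans nkl.
  apply: (le_trans (ler_norm _)); apply: (le_trans (lipW n0'' Ia Ib)).
  rewrite /E kE; apply: (@le_trans _ _ (F (l + nj)%N * (C2 * (k'%:R `^ alpha / (l + nj)%:R `^ alpha)))).
    by rewrite ler_wpM2l// F_ge0// (leq_trans N0_gt0).
  by rewrite le_eqVlt; apply/orP; left; apply/eqP; ring.
(* Only [m] of the [i] factors [rr] are spent on the weight ratio. As [rr <= 1] and [t <= E],
   everything in front of [expR E / W a k'] has modulus at most [Y ^+ s * kappa]. *)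
have -> : (y * (rr b l nj)%:C) ^+ i * (W a (l + nj)%N / W a k')%:C =
   (y ^+ i * (rr b l nj ^+ (i - m) * (W b l * expR (t - E)))%:C)
     * (expR E / W a k')%:C.
  have key : W b l / W b (l + nj)%N * (W a (l + nj)%N / W a k') =
      W b l * expR (t - E) * (expR E / W a k').
    rewrite expRB -W_ratio//; set z := expR E.
    by field; rewrite !gt_eqF ?W_gt0// expR_gt0.
  rewrite exprMn -rmorphXn -!mulrA -!rmorphM/=; congr (_ * _%:C).
  rewrite -{1}(subnK mi) exprD (root_ratioX m_gt0 _ _ (weightI Ib)) -mulrA key.
  by rewrite !mulrA.
rewrite -scalerA.
apply: (@le_trans _ _ ((Y ^+ s * kappa + 1) * (M0 / k'%:R `^ beta))); last first.
  rewrite ler_wpM2l ?addr_ge0 ?mulr_ge0 ?exprn_ge0// ?(ltW kappa_gt0)//.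
  by rewrite ler_pM2l// inv_powR_le// subn_gt0.
apply: (le_trans (Fnorm_scale_le hFnorm _ (_ : _ <= Y ^+ s * kappa))).
  rewrite modulusM modulusX modulus_real.
  apply: ler_pM; rewrite ?exprn_ge0 ?modulus_ge0//.
    apply: (@le_trans _ _ (Y ^+ i)); first by rewrite lerXn2r ?nnegrE ?modulus_ge0.
    by rewrite ler_weXn2l.
  have Wb0 := ltW (W_gt0 l Ib); have r0 := root_ratio_ge0 w m b l nj.
  rewrite ger0_norm; last by rewrite mulr_ge0 ?exprn_ge0// mulr_ge0// expR_ge0.
  rewrite -[leRHS]mul1r; apply: ler_pM; rewrite ?exprn_ge0//.
    by rewrite mulr_ge0// expR_ge0.
    by rewrite exprn_ile1 ?root_ratio_ge0.
  rewrite -[leRHS]mulr1; apply: ler_pM; rewrite ?expR_ge0 ?(ltW (W_gt0 _ Ib)) ?W_le_kappa//.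
  by rewrite -expR0 ler_expR subr_le0.
apply: ler_wpM2l; first by rewrite addr_ge0 ?mulr_ge0 ?exprn_ge0 ?(ltW kappa_gt0).
exact: decay_exp.
Qed.

(** The thresholds [dl] and [N1] depend on the bound [Y] but not on [y] or [L], so the net may be
    chosen after them. *)
Lemma block_hits (Y eps : R) (s : nat) : 1 <= Y -> 0 < eps ->
  exists2 dl : R, 0 < dl & exists N1 : nat,
  forall (y : nat -> R[i]) (L : seq (nat * R)),
    (forall l, modulus (y l) <= Y) -> uniq (map fst L) ->
    (forall x, x \in L -> (N1 <= x.1)%N /\ I0 x.2) ->
    (forall x x', x \in L -> x' \in L -> (x.1 < x'.1)%N ->
      (N1 <= x'.1 - x.1)%N) ->
  (\sum_(x <- L) (x.1%:R `^ beta)^-1 <= dl -> Fnorm (blk y L) < eps) /\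
  forall n1 u0, (forall n, (n1 <= n)%N -> co u0 n = 0) ->
    (forall x, x \in L -> (n1 <= x.1)%N) ->
  forall k a, k \in L -> I0 a -> `|a - k.2| <= dl ->
    (k.1 + p)%:R `^ alpha * `|a - k.2| <= dl ->
    (forall x, x \in L -> (k.1 < x.1)%N -> forall l, (l < p)%N ->
      `|a - x.2| <=
         C2 * ((l + x.1 - k.1)%:R `^ alpha / (l + x.1)%:R `^ alpha)) ->
    \sum_(x <- L | (k.1 < x.1)%N) ((x.1 - k.1)%:R `^ beta)^-1 <= dl ->
  forall i, (m <= i <= s)%N ->
    Fnorm (iter k.1 (T a) (upow S (u0 + blk y L) i)
      - (i == m)%:R *: \sum_(l < p) y l ^+ m *: e_ l) < eps.
Proof.
move=> Y1 eps0; have Y0 : 0 <= Y by exact: le_trans Y1.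
have Ys1 : 1 <= Y ^+ s by rewrite exprn_ege1.
have Ys0 : 0 < Y ^+ s by exact: lt_le_trans Ys1.
have p1 : 0 < p%:R + 1 :> R by rewrite ltr_wpDl.
(* Covers the [p] terms of one piece, with a constant large enough for both [block_term_le] and
   [offdiag_term_le]. *)
pose Q := (p%:R + 1) * (Y ^+ s * kappa + Y * kappa + 1) * M0.
have Q0 : 0 < Q.
  rewrite /Q !mulr_gt0// ltr_wpDl// addr_ge0 ?mulr_ge0 ?(ltW kappa_gt0)// ltW//.
pose e1 := eps / 2 / (p%:R + 1).
have e10 : 0 < e1 by rewrite /e1 !divr_gt0.
have [eta eta0 heta] := unit_vec_small e10.
pose e2 := Num.min 1 (eta / Y ^+ s).
have e20 : 0 < e2 by rewrite lt_min ltr01 divr_gt0.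
have [d1 d10 hd1] := ratio_near1 e20.
pose t := Num.min 1 (eta / 2 / Y ^+ s).
have t0 : 0 < t by rewrite lt_min ltr01 !divr_gt0.
have [N2 hN2] := root_ratio_small t0.
exists (Num.min d1 (eps / 2 / Q)); first by rewrite lt_min d10 !divr_gt0.
exists (maxn N0 (maxn N2 p)) => y L yY uL hL gapL.
have sumQ (D : R) (L' : seq (nat * R)) (P : pred (nat * R)) (g : nat * R -> R)
    (v : nat * R -> nat -> X) : 0 <= D -> D <= Y ^+ s * kappa + Y * kappa + 1 ->
    \sum_(x <- L' | P x) g x <= eps / 2 / Q ->
    (forall x, x \in L' -> P x -> 0 <= g x) ->
    (forall x l, x \in L' -> P x -> (l < p)%N -> Fnorm (v x l) <= D * (M0 * g x)) ->
    Fnorm (\sum_(x <- L' | P x) \sum_(l < p) v x l) <= eps / 2.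
  move=> D0 DQ gQ g0 hv; apply: (le_trans (Fnorm_sum hFnorm _ _ _)).
  apply: (@le_trans _ _ (\sum_(x <- L' | P x) Q * g x)); last first.
    by rewrite -mulr_sumr mulrC -ler_pdivlMr.
  rewrite big_seq_cond [leRHS]big_seq_cond; apply: ler_sum => x /andP[xL Px].
  apply: (le_trans (Fnorm_sum hFnorm _ _ _)).
  apply: (@le_trans _ _ (\sum_(l < p) D * (M0 * g x))).
    by apply: ler_sum => l _; exact: hv.
  rewrite sumr_const card_ord -[leLHS]mulr_natl /Q mulrA -[leRHS]mulrA.
  apply: ler_wpM2r; first by rewrite mulr_ge0 ?(ltW M0_gt0) ?g0.
  by apply: ler_pM => //; rewrite lerDl.
split.
  rewrite le_min => /andP[_ hs].
  apply: (@le_lt_trans _ _ (eps / 2)); last by rewrite ltr_pdivrMr// ltr_pMr// ltr1n.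
  rewrite /block; apply: (sumQ (Y * kappa + 1) L xpredT
    (fun x => (x.1%:R `^ beta)^-1)
    (fun x l => (y l * (rr x.2 l x.1)%:C) *: e_ (l + x.1)%N)) => //.
  - by rewrite addr_ge0 ?mulr_ge0 ?(ltW kappa_gt0).
  - by rewrite -addrA lerDr mulr_ge0 ?(ltW Ys0) ?(ltW kappa_gt0).
  - move=> x l xL _ lp; have [xN xI] := hL _ xL.
    by apply: block_term_le => //; rewrite (leq_trans _ xN)// leq_maxl.
move=> n1 u0 hu0 n1L k a kL Ia ak1 ak2 akx hs i /andP[mi is_].
have [kN kI] := hL _ kL.
have kN0 : (N0 <= k.1)%N by rewrite (leq_trans _ kN)// leq_maxl.
have i0 : (0 < i)%N by exact: leq_trans mi.
have gapp x x' : x \in L -> x' \in L -> (x.1 < x'.1)%N -> (p <= x'.1 - x.1)%N.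
  move=> xL xL' xx; rewrite (leq_trans _ (gapL _ _ xL xL' xx))//.
  by rewrite !leq_max leqnn !orbT.
rewrite (@iter_shift_block _ _ _ hspan _ _ _ m_gt0 y L u0 i n1 a k) ?n1L//; first last.
- exact: admI.
- exact: weightI.
rewrite addrAC scaler_sumr -sumrB.
apply: (le_lt_trans (FnormD hFnorm _ _)).
(* Half of [eps] goes to the later pieces, half to the error of the piece of [k] on the target. *)
rewrite [ltRHS](splitr eps); apply: ltr_leD; last first.
  move: hs; rewrite le_min => /andP[_ hs].
  apply: (sumQ (Y ^+ s * kappa + 1) L (fun x => (k.1 < x.1)%N)
    (fun x => ((x.1 - k.1)%:R `^ beta)^-1)
    (fun x l => ((y l * (rr x.2 l x.1)%:C) ^+ i * (W a (l + x.1)%N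
      / W a (l + x.1 - k.1)%N)%:C) *: e_ (l + x.1 - k.1)%N)) => //.
  - by rewrite addr_ge0 ?mulr_ge0 ?(ltW Ys0) ?(ltW kappa_gt0).
  - by rewrite lerD2r lerDl mulr_ge0 ?(ltW kappa_gt0).
  - move=> x l xL kx lp; have [xN xI] := hL _ xL.
    apply: offdiag_term_le => //.
    + by rewrite mi.
    + by rewrite (leq_trans _ (gapL _ _ kL xL kx))// leq_maxl.
    + apply: le_trans (_ : t <= 1); last by rewrite ge_min lexx.
      apply: hN2 => //; rewrite (leq_trans _ xN)//.
      by rewrite !leq_max leqnn !orbT.
    + exact: akx.
under eq_bigr do rewrite scalerA -scalerBl.
apply: (le_lt_trans (Fnorm_sum hFnorm _ _ _)).
apply: (@le_lt_trans _ _ (\sum_(l < p) e1)); last first.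
  rewrite sumr_const card_ord -[ltLHS]mulr_natr /e1 mulrAC ltr_pdivrMr//.
  by rewrite ltr_pM2l ?divr_gt0// ltrDl.
apply: ler_sum => l _; apply/ltW/heta => //.
have lp := ltn_ord l.
move: ak1 ak2; rewrite !le_min => /andP[ak1 _] /andP[ak2 _].
have near1 := hd1 _ _ _ _ lp kN0 Ia kI ak1 ak2.
set ratio := W k.2 l / _ * _ in near1.
have rE : (y l * (rr k.2 l k.1)%:C) ^+ i * (W a (l + k.1)%N / W a l)%:C =
    y l ^+ i * (rr k.2 l k.1 ^+ (i - m) * ratio)%:C.
  rewrite exprMn -rmorphXn -mulrA -rmorphM/=; congr (_ * _%:C).
  by rewrite -{1}(subnK mi) exprD (root_ratioX m_gt0 _ _ (weightI kI)) -mulrA.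
have yi (j : nat) : (j <= s)%N -> modulus (y l ^+ j) <= Y ^+ s.
  move=> js; rewrite modulusX.
  apply: (@le_trans _ _ (Y ^+ j)); first by rewrite lerXn2r ?nnegrE ?modulus_ge0.
  by rewrite ler_weXn2l.
rewrite rE; have [im|im] := eqVneq i m.
  rewrite im subnn expr0 mul1r mul1r -[X in _ - X]mulr1 -mulrBr.
  rewrite (_ : ratio%:C - 1 = (ratio - 1)%:C); last by rewrite rmorphB.
  rewrite modulusM modulus_real.
  apply: (@le_trans _ _ (Y ^+ s * (eta / Y ^+ s))); last by rewrite mulrC divfK// gt_eqF.
  apply: ler_pM; rewrite ?modulus_ge0 ?yi//; first by rewrite (leq_trans mi).
  by apply: (le_trans near1); rewrite ge_min lexx orbT.
(* Here [i > m]: one factor [rr <= t] is small, the remaining ones are at most [1], and the weight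
   ratio is at most [2]. *)
rewrite mul0r subr0 modulusM modulus_real.
apply: (@le_trans _ _ (Y ^+ s * (eta / 2 / Y ^+ s * 2))); last first.
  by rewrite le_eqVlt; apply/orP; left; apply/eqP; field; rewrite gt_eqF.
apply: ler_pM; rewrite ?modulus_ge0 ?yi//.
have r0 := root_ratio_ge0 w m k.2 l k.1.
have rt : rr k.2 l k.1 <= t.
  by apply: hN2 => //; rewrite (leq_trans _ kN)// !leq_max leqnn !orbT.
rewrite normrM ger0_norm ?exprn_ge0//.
apply: ler_pM; rewrite ?exprn_ge0//.
  have -> : (i - m = (i - m).-1.+1)%N by rewrite prednK// subn_gt0 ltn_neqAle eq_sym im.
  apply: (@le_trans _ _ t); last by rewrite ge_min lexx orbT.
  rewrite exprS -[leRHS]mulr1; apply: ler_pM; rewrite ?exprn_ge0//.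
  rewrite exprn_ile1// (le_trans rt)// ge_min lexx//.
have : e2 <= 1 by rewrite ge_min lexx.
move=> e21; rewrite -[ratio](subrK 1); apply: (le_trans (ler_normD _ _)).
by rewrite normr1 -[2]/(1 + 1) lerD2r (le_trans near1).
Qed.

End Estimates.

(** * Uniformity over compact sets of parameters *)

Section CompactBounds.
Variables (R : realType) (K : set R) (g : R -> R).
Hypothesis cK : compact K.
Hypothesis g_cont : forall a, K a -> g x @[x --> within K (nbhs a)] --> g a.

Lemma compact_upper_bound : exists M : R, forall a, K a -> g a <= M.
Proof.
have /compact_near_coveringP cK' := cK.
have [|M [_ hM]] := cK' _ (+oo : set_system R) (fun M a => K a -> g a <= M) _ _.
  move=> a Ka; have /cvgrPdist_le/(_ _ ltr01) := g_cont Ka.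
  rewrite near_withinE => h.
  exists ([set x | K x -> `|g a - g x| <= 1], [set M | g a + 1 < M]).
    by split => //=; exists (g a + 1); split; rewrite ?num_real.
  move=> [x M] /= [hx hM] Kx; have := hx Kx.
  by rewrite distrC ler_distl => /andP[_ h1]; rewrite (le_trans h1)// ltW.
by exists (M + 1) => a Ka; apply: hM => //; rewrite ltrDl.
Qed.

Lemma compact_ratio_unif (e : R) : (forall a, K a -> 0 < g a) -> 0 < e ->
  exists2 dl : R, 0 < dl & forall a b, K a -> K b -> `|a - b| <= dl ->
    `|g b / g a - 1| <= e.
Proof.
move=> g0 e0; have /compact_near_coveringP cK' := cK.
have [|dl /= dl0 hdl] := cK' _ (0^'+ : set_system R) (fun dl a => K a -> forall b,
    K b -> `|a - b| <= dl -> `|g b / g a - 1| <= e) _ _.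
  (* Chosen so that [2 * e' = e * (g a - e')], where [g a - e'] is a lower bound for the denominator
     [g x]. *)
  move=> a Ka; pose e' := e * g a / (2 + e).
  have e20 : 0 < 2 + e by rewrite addr_gt0.
  have e'0 : 0 < e' by rewrite /e' divr_gt0// mulr_gt0// g0.
  have /cvgrPdist_le/(_ _ e'0) := g_cont Ka.
  rewrite near_withinE => /nbhs_ballP[r /= r0 hr].
  exists (ball a (r / 2), [set dl | dl < r / 2]).
    split; first by apply: nbhsx_ballx; rewrite divr_gt0.
    by apply: nbhs_right_lt; rewrite divr_gt0.
  move=> [x dl] /= [hx hdl] Kx b Kb xb.
  have := hx; rewrite -ball_normE /= => ax.
  have gx : `|g a - g x| <= e'.
    apply: hr => //; rewrite -ball_normE /= (lt_trans ax)//.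
    by rewrite ltr_pdivrMr// ltr_pMr// ltr1n.
  have gb : `|g a - g b| <= e'.
    apply: hr => //; rewrite -ball_normE /=.
    rewrite -(subrK x a) -addrA (le_lt_trans (ler_normD _ _))// (splitr r).
    by rewrite ltrD// (le_lt_trans xb).
  have gx0 := g0 _ Kx.
  rewrite -[X in _ - X](divff (lt0r_neq0 gx0)) -mulrBl normrM normfV (gtr0_norm gx0).
  rewrite ler_pdivrMr//.
  have E : e' * (2 + e) = e * g a by rewrite /e' divfK// gt_eqF.
  apply: (@le_trans _ _ (2 * e')).
    have -> : g b - g x = (g a - g x) - (g a - g b) by ring.
    by rewrite (le_trans (ler_normB _ _))// mulr_natl mulr2n lerD.
  move: gx; rewrite distrC ler_distl => /andP[h _].
  apply: (@le_trans _ _ (e * (g a - e'))); first by rewrite mulrBr; lra.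
  by rewrite ler_pM2l.
pose dl' := dl / 2.
have dl'0 : 0 < dl' by rewrite divr_gt0.
exists dl' => // a b Ka Kb ab; apply: (hdl dl') => //.
by rewrite /ball/= sub0r normrN gtr0_norm// ltr_pdivrMr// ltr_pMr// ltr1n.
Qed.

End CompactBounds.

Section CompactWeights.
Variables (R : realType) (K : set R) (w : R -> nat -> R).
Hypotheses (cK : compact K) (wK : forall a, K a -> weight (w a)).
Hypothesis w_cont : forall n a, (0 < n)%N -> K a ->
  w x n @[x --> within K (nbhs a)] --> w a n.

Lemma weight_prod_cvg n a : K a ->
  weight_prod (w x) n @[x --> within K (nbhs a)] --> weight_prod (w a) n.
Proof.
move=> Ka; elim: n => [|n IH].
  by under eq_fun do rewrite weight_prod0; rewrite weight_prod0; exact: cvg_cst.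
under eq_fun do rewrite weight_prodS.
by rewrite weight_prodS; apply: cvgM => //; exact: w_cont.
Qed.

Lemma weight_prod_bounded p : exists2 kappa : R, 1 <= kappa &
  forall l a, (l < p)%N -> K a -> weight_prod (w a) l <= kappa.
Proof.
elim: p => [|p [k k1 IH]]; first by exists 1.
have [M hM] := compact_upper_bound cK (@weight_prod_cvg p).
exists (Num.max k M); first by rewrite le_max k1.
move=> l a; rewrite ltnS leq_eqVlt le_max => /orP[/eqP -> /hM ->|lp /IH ->//].
by rewrite orbT.
Qed.

Lemma weight_prod_unif p (e : R) : 0 < e -> exists2 dl : R, 0 < dl &
  forall l a b, (l < p)%N -> K a -> K b -> `|a - b| <= dl ->
  `|weight_prod (w b) l / weight_prod (w a) l - 1| <= e.
Proof.
move=> e0; elim: p => [|p [k k0 IH]]; first by exists 1.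
have [|dl dl0 hdl] := compact_ratio_unif cK (@weight_prod_cvg p) _ e0.
  by move=> a Ka; exact/weight_prod_gt0/wK.
exists (Num.min k dl); first by rewrite lt_min k0.
move=> l a b; rewrite ltnS leq_eqVlt le_min.
by move=> /orP[/eqP ->|lp] Ka Kb /andP[h1 h2]; [exact: hdl|exact: IH].
Qed.

End CompactWeights.

(** * Nets in cubes *)

Lemma digit_ex (R : realType) (b : nat) (h x : R) : 0 <= h -> (0 < b)%N ->
  0 <= x -> x <= b%:R * h -> exists t : 'I_b, t%:R * h <= x <= t%:R * h + h.
Proof.
move=> h0; case: b => // b _; elim: b => [|b IH] x0 xb.
  by exists ord0; rewrite mul0r add0r x0 -[leRHS]mul1r.
have [xb'|xb'] := lerP x (b.+1%:R * h).
  by have [t ht] := IH x0 xb'; exists (widen_ord (leqnSn _) t).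
exists ord_max; apply/andP; split; first exact: ltW.
by rewrite /= -[X in _ + X]mul1r -mulrDl natr1.
Qed.

Lemma powR_unbounded (R : realType) (beta : R) : 0 < beta ->
  forall K : R, exists N0 : nat, forall n, (N0 <= n)%N -> K <= n%:R `^ beta.
Proof.
move=> b0 K; pose K' := Num.max K 1.
have K'0 : 0 <= K' by rewrite le_max ler01 orbT.
exists (Num.bound (K' `^ beta^-1)) => n hn.
apply: (@le_trans _ _ K'); first by rewrite le_max lexx.
have kn : K' `^ beta^-1 <= n%:R.
  rewrite (le_trans (ltW (archi_boundP (powR_ge0 K' beta^-1))))//.
  by rewrite ler_nat.
have : (K' `^ beta^-1) `^ beta <= n%:R `^ beta.
  by apply: ge0_ler_powR; rewrite ?nnegrE ?powR_ge0 ?(ltW b0).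
by rewrite -powRrM mulVf ?gt_eqF// powRr1.
Qed.

Lemma expr_small (R : realType) (z e : R) : 0 <= z < 1 -> 0 < e ->
  exists r : nat, z ^+ r <= e.
Proof.
move=> /andP[z0 z1] e0; have : `|z| < 1 by rewrite ger0_norm.
move=> /cvg_expr/cvgrPdist_le/(_ _ e0)[r _ /(_ r (leqnn r))] /=.
by rewrite sub0r normrN ger0_norm ?exprn_ge0// => h; exists r.
Qed.

Section BoxNet.
Variables (R : realType) (d : nat) (I0 : set R) (alpha beta C2 : R).
Hypotheses (d_gt0 : (0 < d)%N) (alpha_gt0 : 0 < alpha) (C2_gt0 : 0 < C2).
Hypotheses (ad1 : alpha * d%:R < 1) (adb : alpha * d%:R < beta).

Let maxdist (x y : 'I_d -> R) : R := \big[Num.max/0]_(i < d) `|x i - y i|.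

(** Intersecting the cube with [I0] in each coordinate keeps the net parameters inside [I0]; the
    result may be empty. *)
Let box (side : R) (A : set ('I_d -> R)) := exists c : 'I_d -> R,
  A = [set q | forall i, I0 (q i) /\ c i <= q i <= c i + side].

Let maxdist_le x y e : 0 <= e ->
  (forall i, `|x i - y i| <= e) -> maxdist x y <= e.
Proof. by move=> e0 h; apply: bigmax_le. Qed.

Let le_maxdist x y i : `|x i - y i| <= maxdist x y.
Proof. exact: (le_bigmax _ (fun i => `|x i - y i|) i). Qed.

Lemma box_dist side A : 0 <= side -> box side A ->
  forall x y, A x -> A y -> maxdist x y <= side.
Proof.
move=> s0 [c ->] x y /= hx hy; apply: maxdist_le => // i.
have [_ /andP[x1 x2]] := hx i; have [_ /andP[y1 y2]] := hy i.
rewrite ler_norml; apply/andP; split; lra.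
Qed.

Lemma box_split (b : nat) h A : (0 < b)%N -> 0 <= h -> box (b%:R * h) A ->
  exists f : 'I_#|{ffun 'I_d -> 'I_b}| -> set ('I_d -> R),
  [/\ forall i, box h (f i), forall i, f i `<=` A & A `<=` \bigcup_i f i].
Proof.
move=> b0 h0 [c AE].
exists (fun j => [set q | forall i, I0 (q i) /\
  c i + ((enum_val j : {ffun 'I_d -> 'I_b}) i)%:R * h <= q i <= c i + ((enum_val j : {ffun 'I_d -> 'I_b}) i)%:R * h + h]).
split.
- by move=> j; exists (fun i => c i + ((enum_val j : {ffun 'I_d -> 'I_b}) i)%:R * h).
- move=> j q /= hq; rewrite AE => i /=; have [Iq /andP[q1 q2]] := hq i.
  split=> //; apply/andP; split.
    by apply: le_trans q1; rewrite lerDl mulr_ge0.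
  apply: (le_trans q2); rewrite -addrA lerD2l -[X in _ + X]mul1r -mulrDl natr1.
  by rewrite ler_wpM2r// ler_nat.
- rewrite AE => q hq /=.
  have dig i : exists t : 'I_b, t%:R * h <= q i - c i <= t%:R * h + h.
    have [_ /andP[q1 q2]] := hq i.
    by apply: digit_ex => //; [rewrite subr_ge0|rewrite lerBlDl].
  have [t ht] := choice dig.
  exists (enum_rank [ffun i => t i]) => // i; rewrite enum_rankK ffunE.
  have [Iq _] := hq i; split=> //; have /andP[t1 t2] := ht i.
  apply/andP; split; lra.
Qed.

Let scale_ratio (B b : nat) (s r : nat) : (s <= r)%N -> (0 < b)%N -> (0 < B)%N ->
  B%:R `^ alpha <= b%:R ->
  b%:R ^+ s / b%:R ^+ r <= (B%:R `^ alpha) ^+ s / (B%:R `^ alpha) ^+ r :> R.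
Proof.
move=> sr b0 B0 Bb.
have X0 : 0 < B%:R `^ alpha :> R by rewrite powR_gt0// ltr0n.
have b0R : (0 : R) < b%:R by rewrite ltr0n.
rewrite -(subnK sr) !exprD !invfM !mulrA.
rewrite [X in X / _ ^+ s <= _]mulrC [X in _ <= X / _ ^+ s]mulrC.
rewrite !mulfK ?expf_neq0 ?gt_eqF//.
by rewrite lef_pV2 ?posrE ?exprn_gt0// lerXn2r ?nnegrE// ltW.
Qed.

(** The side [rho] does not depend on [c], [dl] or [N1]: cubes of one fixed size carry nets of any
    accuracy, so countably many cubes suffice later. *)
Lemma box_net : exists2 rho : R, 0 < rho &
  forall (c : 'I_d -> R) (dl : R) (N1 : nat), 0 < dl ->
  exists L : seq (nat * ('I_d -> R)),
  [/\ uniq (map fst L),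
      forall x, x \in L -> (N1 <= x.1)%N /\ forall i, I0 (x.2 i),
      forall x x', x \in L -> x' \in L -> (x.1 < x'.1)%N -> (N1 <= x'.1 - x.1)%N,
      \sum_(x <- L) (x.1%:R `^ beta)^-1 <= dl &
      forall q : 'I_d -> R, (forall i, I0 (q i) /\ c i <= q i <= c i + rho) ->
      exists2 k, k \in L & [/\
        (0 < k.1)%N,
        forall i, `|q i - k.2 i| <= dl /\
          (k.1 + N1)%:R `^ alpha * `|q i - k.2 i| <= dl,
        forall x, x \in L -> (k.1 < x.1)%N -> forall l i, (l <= N1)%N ->
          `|q i - x.2 i| <=
            C2 * ((l + x.1 - k.1)%:R `^ alpha / (l + x.1)%:R `^ alpha) &
        \sum_(x <- L | (k.1 < x.1)%N) ((x.1 - k.1)%:R `^ beta)^-1 <= dl]].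
Proof.
have [P [q0 [q0_gt0 h1 h2 h3]]] := scale_exponents alpha_gt0 d_gt0 ad1 adb.
have beta_gt0 : 0 < beta by apply: le_lt_trans adb; rewrite mulr_ge0// ltW.
pose b := (2 ^ q0)%N; pose B := (2 ^ P)%N; pose M := #|{ffun 'I_d -> 'I_b}|.
have ME : M = (2 ^ (q0 * d))%N by rewrite /M card_ffun !card_ord -expnM.
have b_gt0 : (0 < b)%N by rewrite expn_gt0.
have B_gt0 : (0 < B)%N by rewrite expn_gt0.
have bR : (0 : R) < b%:R by rewrite ltr0n.
have M_gt0 : (0 < M)%N by rewrite ME expn_gt0.
have MB : (2 * M <= B)%N by rewrite ME -expnS leq_exp2l.
have Bexp (z : R) : B%:R `^ z = 2 `^ (P%:R * z).
  by rewrite natrX -powR_mulrn// -powRrM.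
have two_lt (y z : R) : y < z -> 2 `^ y < 2 `^ z :> R.
  by move=> yz; rewrite /powR gt_eqF// ltr_expR ltr_pM2r// ln_gt0// ltr1n.
have natE n : (2 ^ n)%:R = 2 `^ n%:R :> R by rewrite natrX powR_mulrn.
have Bb : B%:R `^ alpha < b%:R by rewrite Bexp natE two_lt.
have theta1 : M%:R / B%:R `^ beta < 1.
  by rewrite ltr_pdivrMr ?powR_gt0 ?ltr0n// mul1r ME Bexp natE two_lt.
have BX0 : 0 < B%:R `^ alpha :> R by rewrite powR_gt0// ltr0n.
(* The factor 3 reflects [l + x.1 <= 3 * N * B ^ r] in a net of depth [r]. *)
pose rho := C2 / (2 * b%:R * 3 `^ alpha).
have rho0 : 0 < rho by rewrite divr_gt0// !mulr_gt0// powR_gt0.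
exists rho => // c dl N1 dl0.
pose E0 : R := M%:R / (1 - M%:R / B%:R `^ beta).
(* The first bound controls the sum over all times, the second the sums over gaps; neither involves
   the depth. *)
have [N2 hN2] := powR_unbounded beta_gt0 (Num.max (dl^-1) (E0 / dl)).
pose N := maxn N1.+1 N2.
have N_gt0 : (0 < N)%N by rewrite leq_max.
have N1N : (N1 < N)%N by rewrite leq_max leqnn.
have := hN2 N (leq_maxr _ _); rewrite ge_max => /andP[hNa hNb].
have Nb0 : 0 < N%:R `^ beta :> R by rewrite powR_gt0// ltr0n.
(* The depth comes after [N] and makes [(3 * g) ^ alpha] times the finest side at most [dl], using
   [B ^ alpha < b]. *)
have [r hr] : exists r : nat,
    (B%:R `^ alpha / b%:R) ^+ r <= dl / ((3 * N)%:R `^ alpha * rho).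
  apply: expr_small; last first.
    by rewrite divr_gt0// mulr_gt0// powR_gt0// ltr0n muln_gt0.
  by rewrite divr_ge0 ?(ltW BX0)//= ltr_pdivrMr// mul1r.
pose eta := rho / b%:R ^+ r.
have eta0 : 0 < eta by rewrite divr_gt0// exprn_gt0.
pose piece s A := box (eta * b%:R ^+ s) A.
pose g := (N * B ^ r)%N.
have bs0 s : 0 <= eta * b%:R ^+ s by rewrite mulr_ge0// ?(ltW eta0)// exprn_ge0.
have pS s A : piece s.+1 A -> exists f : 'I_M -> set ('I_d -> R),
    [/\ forall i, piece s (f i), forall i, f i `<=` A & A `<=` \bigcup_i f i].
  rewrite /piece (_ : eta * b%:R ^+ s.+1 = b%:R * (eta * b%:R ^+ s)); last first.
    by rewrite exprS mulrCA.
  exact: box_split.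
have pD s A : piece s A -> forall x y, A x -> A y -> maxdist x y <= eta * b%:R ^+ s.
  exact: box_dist.
have rhoE : eta * b%:R ^+ r = rho by rewrite divfK// expf_neq0// gt_eqF.
pose A0 := [set q : 'I_d -> R | forall i, I0 (q i) /\ c i <= q i <= c i + rho].
have pA0 : piece r A0 by rewrite /piece rhoE; exists c.
have [L [uL sL LA Lnet [Lgap Lsum]]] :=
  gap_net pS pD M_gt0 N_gt0 MB beta_gt0 theta1 pA0.
rewrite -/g in LA.
have g_gt0 : (0 < g)%N by rewrite muln_gt0 N_gt0 expn_gt0 B_gt0.
have Ng : (N <= g)%N by rewrite leq_pmulr// expn_gt0 B_gt0.
(* Translating by [g] places all times between [g] and [2 * g], so they are large and comparable,
   while their gaps stay the same. *)
pose sh (x : nat * ('I_d -> R)) := ((g + x.1)%N, x.2).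
exists (map sh L).
have gE : g%:R `^ alpha = N%:R `^ alpha * (B%:R `^ alpha) ^+ r :> R.
  by rewrite natrM powRM// natrX_powR.
split.
- rewrite -map_comp (_ : map _ _ = map (addn g) (map fst L)).
    by rewrite map_inj_uniq//; exact: addnI.
  by rewrite -map_comp.
- move=> _ /mapP[x xL ->] /=; split; first by rewrite (leq_trans (ltnW N1N))// (leq_trans Ng)// leq_addr.
  by have [_ /= hx] := LA _ xL; move=> i; have [] := hx i.
- move=> _ _ /mapP[x xL ->] /mapP[y yL ->] /=; rewrite ltn_add2l subnDl => xy.
  have [s [_ hs _]] := Lgap _ _ xL yL xy.
  rewrite (leq_trans (ltnW N1N))// (leq_trans _ hs)// leq_pmulr// expn_gt0 B_gt0//.
- rewrite big_map.
  apply: (@le_trans _ _ (\sum_(x <- L) (g%:R `^ beta)^-1)).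
    by apply: ler_sum => x _; apply: inv_powR_le => //=; rewrite leq_addr.
  rewrite big_const_seq count_predT iter_addr addr0 -[leLHS]mulr_natl.
  rewrite natrM powRM// natrX_powR invfM mulrA.
  rewrite mulrAC ler_pdivrMr//.
  apply: (@le_trans _ _ 1); last by rewrite mulrC -ler_pdivrMr// mul1r.
  rewrite ler_pdivrMr ?exprn_gt0 ?powR_gt0 ?ltr0n// mul1r.
  apply: (@le_trans _ _ (M%:R ^+ r)); first by rewrite -natrX ler_nat.
  rewrite lerXn2r ?nnegrE ?powR_ge0// -[leRHS]mul1r -ler_pdivrMr ?powR_gt0 ?ltr0n//.
  exact: ltW.
move=> q hq; have [k kL qk] := Lnet q hq.
have dist_eta i : `|q i - k.2 i| <= eta.
  by apply: le_trans (le_maxdist _ _ _) _; rewrite (le_trans qk)// expr0 mulr1.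
exists (sh k); first exact: map_f.
have [kg _] := LA _ kL.
split => /=.
- by rewrite addn_gt0 g_gt0.
- move=> i.
  have key : (g + k.1 + N1)%:R `^ alpha * `|q i - k.2 i| <= dl.
    apply: (@le_trans _ _ ((3 * g)%:R `^ alpha * eta)).
      apply: ler_pM; rewrite ?powR_ge0//.
      apply: ge0_ler_powR; rewrite ?nnegrE ?(ltW alpha_gt0)// ler_nat.
      by rewrite !mulSn mul0n addn0 addnA; apply: leq_add; [exact: leq_add|exact: leq_trans (ltnW N1N) Ng].
    have -> : (3 * g)%:R `^ alpha * eta =
        ((3 * N)%:R `^ alpha * rho) * (B%:R `^ alpha / b%:R) ^+ r.
      rewrite /g mulnA natrM powRM// natrX_powR expr_div_n /eta; ring.
    rewrite mulrC -ler_pdivlMr// mulr_gt0// powR_gt0//.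
    by rewrite ltr0n muln_gt0.
  split=> //; apply: le_trans key; rewrite ler_peMl//.
  by rewrite -[leLHS](powRr0 (g + k.1 + N1)%:R) ler_powR// ?(ltW alpha_gt0)// ler1n !addn_gt0 g_gt0.
- move=> _ /mapP[x xL ->] /=; rewrite ltn_add2l => kx l i lN1.
  have [s [sr hs hd]] := Lgap _ _ kL xL kx.
  have [xg _] := LA _ xL.
  (* Triangle inequality through [k]: the distance to [k] is at most the finest side, and [k] and
     [x] share a cube of level [s.+1]. The factor [2 * b] in [rho] absorbs the [2] and the step from
     [s] to [s.+1]. *)
  apply: (@le_trans _ _ (2 * (eta * b%:R ^+ s.+1))).
    rewrite -(subrK (k.2 i) (q i)) -addrA (le_trans (ler_normD _ _))//.
    rewrite mulr_natl mulr2n lerD//; last exact: le_trans (le_maxdist _ _ _) hd.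
    apply: (le_trans (dist_eta i)); rewrite ler_peMr ?(ltW eta0)//.
    by rewrite exprn_ege1// ler1n.
  have num : (N * B ^ s)%:R `^ alpha <= (l + (g + x.1) - (g + k.1))%:R `^ alpha :> R.
    apply: ge0_ler_powR; rewrite ?nnegrE ?(ltW alpha_gt0)// ler_nat.
    by rewrite addnCA subnDl (leq_trans hs)// leq_sub2r// leq_addl.
  have den : (l + (g + x.1))%:R `^ alpha <= (3 * g)%:R `^ alpha :> R.
    apply: ge0_ler_powR; rewrite ?nnegrE ?(ltW alpha_gt0)// ler_nat.
    rewrite !mulSn mul0n addn0; apply: leq_add; last exact: leq_add.
    exact: leq_trans lN1 (leq_trans (ltnW N1N) Ng).
  have den0 : 0 < (l + (g + x.1))%:R `^ alpha :> R.
    by rewrite powR_gt0// ltr0n !addn_gt0 g_gt0 orbT.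
  apply: (@le_trans _ _ (C2 * ((N * B ^ s)%:R `^ alpha / (3 * g)%:R `^ alpha))).
    rewrite /g !natrM !powRM ?mulr_ge0// !(natrX_powR B).
    set X := B%:R `^ alpha in BX0 Bb *; set Na := N%:R `^ alpha.
    have Na0 : 0 < Na by rewrite powR_gt0// ltr0n.
    have t0 : 0 < 3 `^ alpha :> R by rewrite powR_gt0.
    have -> : C2 * (Na * X ^+ s / (3 `^ alpha * (Na * X ^+ r))) =
        C2 / 3 `^ alpha * (X ^+ s / X ^+ r).
      by field; rewrite !gt_eqF ?exprn_gt0.
    have -> : 2 * (eta * b%:R ^+ s.+1) = C2 / 3 `^ alpha * (b%:R ^+ s / b%:R ^+ r).
      rewrite /eta /rho exprS; field.
      by rewrite !gt_eqF ?exprn_gt0.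
    rewrite ler_pM2l ?divr_gt0//; apply: scale_ratio => //; [exact: ltnW|exact: ltW].
  rewrite ler_pM2l//; apply: ler_pM => //; rewrite ?invr_ge0 ?powR_ge0//.
  rewrite lef_pV2 ?posrE// powR_gt0// ltr0n muln_gt0//.
- rewrite big_map.
  under eq_bigl do rewrite /= ltn_add2l.
  under eq_bigr do rewrite /= subnDl.
  apply: (le_trans (Lsum _ kL)).
  have t0 : 0 <= M%:R / B%:R `^ beta :> R by rewrite divr_ge0// powR_ge0.
  apply: (@le_trans _ _ (M%:R / N%:R `^ beta / (1 - M%:R / B%:R `^ beta))).
    have h : 1 - (M%:R / B%:R `^ beta) ^+ r <= 1 :> R by rewrite gerBl exprn_ge0.
    rewrite ler_piMr//.
    by rewrite !divr_ge0 ?powR_ge0// subr_ge0 ltW.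
  by rewrite mulrAC -/E0 ler_pdivrMr// mulrC -ler_pdivrMr.
Qed.

End BoxNet.

(** * Density *)

Section Density.
Variables (R : realType) (X : topologicalLmodType R[i]).
Variables (S : coordwiseFrechetAlgebra X) (Fnorm : X -> R).
Hypotheses (hFnorm : is_Fnorm Fnorm) (hspan : unit_vec_span_dense S).
Variables (d : nat) (alpha : R) (w : R -> nat -> R) (I0 : set R) (m : nat).
Hypotheses (d_gt0 : (0 < d)%N) (alpha_gt0 : 0 < alpha) (ad1 : alpha * d%:R < 1).
Hypotheses (cI0 : compact I0) (m_gt0 : (0 < m)%N).
Hypothesis weightI : forall a, I0 a -> weight (w a).
Hypothesis admI : forall a, I0 a -> admissible S (w a).
Hypothesis w_cont : forall n a, (0 < n)%N -> I0 a ->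
  w x n @[x --> within I0 (nbhs a)] --> w a n.
Hypothesis growth : exists (C1 C2 beta : R) (F : nat -> R) (N0 : nat) (M0 : R),
  [/\ 0 < C1, 0 < C2, alpha * d%:R < beta, (0 < N0)%N & 0 < M0] /\
  (forall n, (1 <= n)%N -> 0 < F n /\ F n <= C1 * n%:R `^ alpha) /\
  (forall n, (N0 <= n)%N ->
    [/\ (F n).-lipschitz_I0 (fun a : R => \sum_(1 <= i < n.+1) ln (w a i)),
        ereal_inf [set (weight_prod (w a) k)%:E | a in I0] @[k --> \oo] --> +oo%E &
        forall a k, I0 a -> (N0 <= k)%N ->
          Fnorm ((expR (C2 * (F (n + k)%N / (n + k)%:R `^ alpha) * k%:R `^ alpha)
            / weight_prod (w a) k)%:C *: unit_vec S k) <= M0 / k%:R `^ beta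
          /\ Fnorm ((1 / weight_prod (w a) k `^ (1 / m%:R))%:C *: unit_vec S k)
            <= M0 / k%:R `^ beta]).

(** The witness adds to each [u0 i] a block with the times of one common net and the [i]-th
    coordinates of its parameters, so a single [N] serves all components. *)
Lemma hit_dense : exists2 rho : R, 0 < rho &
  forall (c : 'I_d -> R) (t : 'I_d -> nat -> R[i]) (p s n1 : nat) (eps : R)
    (u0 : 'I_d -> X), 0 < eps ->
    (forall i n, (n1 <= n)%N -> seq_coord S (u0 i) n = 0) ->
  exists u : 'I_d -> X, (forall i, Fnorm (u i - u0 i) < eps) /\
  forall q : 'I_d -> R, (forall i, I0 (q i) /\ c i <= q i <= c i + rho) ->
  exists2 N, (0 < N)%N & forall i j, (m <= j <= s)%N ->
    Fnorm (iter N (backward_shift S (w (q i))) (upow S (u i) j)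
      - (j == m)%:R *: \sum_(l < p) t i l *: unit_vec S l) < eps.
Proof.
have [C1 [C2 [beta [F [N0 [M0 [[C10 C20 adb N00 M00] [HF HN]]]]]]]] := growth.
have beta_gt0 : 0 < beta by apply: le_lt_trans adb; rewrite mulr_ge0// ltW.
have [rho rho0 hnet] := box_net I0 d_gt0 alpha_gt0 C20 ad1 adb.
exists rho => // c t p s n1 eps u0 eps0 hu0.
have F_ge0 n : (0 < n)%N -> 0 <= F n by move=> /HF[/ltW].
have F_le n : (0 < n)%N -> F n <= C1 * n%:R `^ alpha by move=> /HF[].
have lipW n a b : (N0 <= n)%N -> I0 a -> I0 b ->
    `|ln (weight_prod (w a) n) - ln (weight_prod (w b) n)| <= F n * `|a - b|.
  move=> /HN[lip _ _] Ia Ib.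
  rewrite !ln_weight_prod; [|exact: weightI|exact: weightI].
  exact: (lip (a, b)).
have infW (A : R) : exists k0, forall k a, (k0 <= k)%N -> I0 a -> A <= weight_prod (w a) k.
  have [_ /cvgeyPge/(_ A)[k0 _ hk] _] := HN N0 (leqnn _).
  exists k0 => k a /hk /= h Ia; rewrite -lee_fin (le_trans h)//.
  by apply: ereal_inf_lbound; exists a.
have dexp n k a : (N0 <= n)%N -> (N0 <= k)%N -> I0 a ->
  Fnorm ((expR (C2 * (F (n + k)%N / (n + k)%:R `^ alpha) * k%:R `^ alpha)
    / weight_prod (w a) k)%:C *: unit_vec S k) <= M0 / k%:R `^ beta.
  by move=> /HN[_ _ h] kN Ia; have [] := h _ _ Ia kN.
have droot k a : (N0 <= k)%N -> I0 a ->
  Fnorm ((1 / weight_prod (w a) k `^ (1 / m%:R))%:C *: unit_vec S k) <= M0 / k%:R `^ beta.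
  by move=> kN Ia; have [_ _ h] := HN N0 (leqnn _); have [] := h _ _ Ia kN.
have [kappa kappa1 hkappa] := weight_prod_bounded cI0 w_cont p.
have Wunif := weight_prod_unif cI0 weightI w_cont p.
pose y i l := if (l < p)%N then m.-root (t i l) else 0.
pose Y : R := 1 + \sum_(i < d) \sum_(l < p) modulus (y i l).
have Y1 : 1 <= Y by rewrite lerDl; apply: sumr_ge0 => i _; apply: sumr_ge0 => l _; exact: modulus_ge0.
have yY i l : modulus (y i l) <= Y.
  have [lp|pl] := ltnP l p; last first.
    have -> : y i l = 0 by rewrite /y ltnNge pl.
    by rewrite modulus0 (le_trans _ Y1).
  rewrite /Y (bigD1 i)//= (bigD1 (Ordinal lp))//=.
  have h1 : 0 <= \sum_(l0 < p | l0 != Ordinal lp) modulus (y i l0).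
    by apply: sumr_ge0 => j _; exact: modulus_ge0.
  have h2 : 0 <= \sum_(i0 < d | i0 != i) \sum_(l0 < p) modulus (y i0 l0).
    by apply: sumr_ge0 => j _; apply: sumr_ge0 => l' _; exact: modulus_ge0.
  lra.
have [dl dl0 [N1 hhits]] := block_hits hFnorm hspan m_gt0 weightI admI alpha_gt0
  beta_gt0 C10 M00 N00 F_ge0 F_le lipW infW dexp droot kappa1 hkappa Wunif s Y1 eps0.
(* [p] lets the net tolerate the offsets [l < p]; [n1] puts all times beyond the support of [u0]. *)
have [L [uL LN Lgap Lsum Lcov]] := hnet c dl (maxn N1 (maxn p n1)) dl0.
pose Li (i : 'I_d) := [seq (x.1, x.2 i) | x <- L].
have hits i := hhits (y i) (Li i) (yY i).
have uLi i : uniq (map fst (Li i)) by rewrite -map_comp.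
have N1max : (N1 <= maxn N1 (maxn p n1))%N by rewrite leq_maxl.
have pmax : (p <= maxn N1 (maxn p n1))%N by rewrite !leq_max leqnn orbT.
have n1max : (n1 <= maxn N1 (maxn p n1))%N by rewrite !leq_max leqnn !orbT.
have LiN i x : x \in Li i -> (N1 <= x.1)%N /\ I0 x.2.
  move=> /mapP[z zL ->] /=; have [h1 h2] := LN _ zL.
  by split=> //; exact: leq_trans h1.
have Ligap i x x' : x \in Li i -> x' \in Li i -> (x.1 < x'.1)%N -> (N1 <= x'.1 - x.1)%N.
  move=> /mapP[z zL ->] /mapP[z' zL' ->] /= zz.
  exact: leq_trans (Lgap _ _ zL zL' zz).
exists (fun i => u0 i + block S w m p (y i) (Li i)); split.
  move=> i; rewrite addrC addKr.
  have [+ _] := hits i (uLi i) (LiN i) (Ligap i); apply.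
  by rewrite big_map.
move=> q hq; have [k kL [k0 kq kx ksum]] := Lcov q hq.
exists k.1 => // i j jms.
have [_ +] := hits i (uLi i) (LiN i) (Ligap i).
have n1Li x : x \in Li i -> (n1 <= x.1)%N.
  by move=> /mapP[z zL ->] /=; have [h1 _] := LN _ zL; exact: leq_trans h1.
move=> /(_ n1 (u0 i) (hu0 i) n1Li (k.1, k.2 i) (q i)) /=.
have -> : \sum_(l < p) t i l *: unit_vec S l = \sum_(l < p) y i l ^+ m *: unit_vec S l.
  by apply: eq_bigr => l _; rewrite /y ltn_ord rootCK.
have [kq1 kq2] := kq i; have [Iq _] := hq i.
apply => //.
- by apply/mapP; exists k.
- apply: le_trans kq2; rewrite ler_wpM2r//.
  by apply: ge0_ler_powR; rewrite ?nnegrE ?(ltW alpha_gt0)// ler_nat leq_add2l.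
- move=> _ /mapP[x xL ->] /= kx1 l lp; apply: kx => //.
  by rewrite (leq_trans (ltnW lp)).
- by rewrite big_map.
Qed.

End Density.

(** * Openness and Baire category *)

Lemma ord_min_pos (R : realType) (J : finType) (e : J -> R) :
  (forall i, 0 < e i) -> exists2 e0 : R, 0 < e0 & forall i, e0 <= e i.
Proof.
move=> e_gt0; have h : \forall x \near (0 : R)^'+, forall i, x <= e i.
  by apply: filter_forall => i; exact: nbhs_right_le.
have [x [x0 hx]] := @filter_ex _ _ _ _ (filterI (nbhs_right_gt (0 : R)) h).
by exists x.
Qed.

Section PointwiseBalls.
Variables (R : realType) (Z : topologicalType) (D : Z -> Z -> R).
Hypothesis D_nbhs : forall (z : Z) A,
  nbhs z A <-> exists2 e : R, 0 < e & forall y, D y z < e -> A y.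

Lemma nbhs_ptws_ball n (f : {ptws 'I_n -> Z}) (A : set {ptws 'I_n -> Z}) :
  nbhs f A <-> exists2 e : R, 0 < e & forall g, (forall i, D (g i) (f i) < e) -> A g.
Proof.
split=> [fA|[e e0 eA]]; last first.
  have : \forall g \near f, forall i, D (g i) (f i) < e.
    apply: (@filter_forall _ _ (fun i (g : {ptws 'I_n -> Z}) => D (g i) (f i) < e)
      (nbhs f) (nbhs_filter f)) => i.
    have /(_ [set y | D y (f i) < e]) := @proj_continuous _ (fun _ : 'I_n => Z) i f.
    by apply; apply/D_nbhs; exists e.
  by apply: (@filterS _ (nbhs f) (nbhs_filter f)) => g; exact: eA.
pose B (e : R) := [set g : {ptws 'I_n -> Z} | forall i, D (g i) (f i) < e].
(* The uniform balls generate a filter converging to [f] in each coordinate, hence in the pointwise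
   topology, so every neighbourhood of [f] contains such a ball. *)
pose F : set_system {ptws 'I_n -> Z} := filter_from [set e : R | 0 < e] B.
have FF : Filter F.
  apply: filter_from_filter; first by exists (1 : R); exact: ltr01.
  move=> e1 e2 /= e10 e20; exists (Num.min e1 e2) => /=.
    by rewrite lt_min e10.
  by move=> g hg; split=> i; have := hg i; rewrite lt_min => /andP[].
have Ff : F --> f.
  apply/cvg_sup => i U [V] [[W] oW <-] Wf WU.
  have /D_nbhs[e e0 eW] : nbhs (f i) W by apply: open_nbhs_nbhs.
  by exists e => // g hg; apply: WU; apply: eW; exact: hg.
by have [e e0 eA] := Ff _ fA; exists e.
Qed.

End PointwiseBalls.

Lemma nbhs_dist (R : realType) (z : R) (A : set R) :
  nbhs z A <-> exists2 e : R, 0 < e & forall y, `|y - z| < e -> A y.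
Proof.
split=> [/nbhs_ballP[e e0 h]|[e e0 h]].
  by exists e => // y hy; apply: h; rewrite -ball_normE /= distrC.
by apply/nbhs_ballP; exists e => // y; rewrite -ball_normE /= distrC => /h.
Qed.

Section Openness.
Variables (R : realType) (X : topologicalLmodType R[i]).
Variables (S : coordwiseFrechetAlgebra X) (Fnorm : X -> R).
Hypotheses (hFnorm : is_Fnorm Fnorm).
Variables (d : nat) (I : set R) (w : R -> nat -> R).
Hypothesis hcont : continuous_family S d I w.
Local Notation T q := (product_shift S w q).
Local Notation close e u v := (forall i, Fnorm (u i - v i) < e).

Lemma iter_product_shift (q : 'I_d -> R) N v i :
  iter N (T q) v i = iter N (backward_shift S (w (q i))) (v i).
Proof. by elim: N => //= N IH; rewrite /product_shift IH. Qed.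

Lemma product_shift_continuous (q : 'I_d -> R) (v : 'I_d -> X) (e : R) :
  (forall i, I (q i)) -> 0 < e -> exists2 dl : R, 0 < dl &
    forall q' v', (forall i, I (q' i)) -> (forall i, `|q' i - q i| < dl) ->
      close dl v' v -> close e (T q' v') (T q v).
Proof.
move=> Iq e0; have /subspace_continuousP/(_ (q, v) Iq) := hcont.2.
have nb : nbhs (T q v : {ptws 'I_d -> X}) [set g | close e g (T q v)].
  by apply/(nbhs_ptws_ball (nbhs_Fnorm hFnorm)); exists e.
move=> /(_ _ nb) [[U V] /= [Uq Vv] UV].
have [d1 d10 hd1] := (nbhs_ptws_ball (@nbhs_dist R) _ _).1 Uq.
have [d2 d20 hd2] := (nbhs_ptws_ball (nbhs_Fnorm hFnorm) _ _).1 Vv.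
exists (Num.min d1 d2); first by rewrite lt_min d10.
move=> q' v' Iq' hq hv; apply: (UV (q', v')) => //; split.
  by apply: hd1 => i; have := hq i; rewrite lt_min => /andP[].
by apply: hd2 => i; have := hv i; rewrite lt_min => /andP[].
Qed.

Lemma iter_product_shift_continuous N (q : 'I_d -> R) (v : 'I_d -> X) (e : R) :
  (forall i, I (q i)) -> 0 < e -> exists2 dl : R, 0 < dl &
    forall q' v', (forall i, I (q' i)) -> (forall i, `|q' i - q i| < dl) ->
      close dl v' v -> close e (iter N (T q') v') (iter N (T q) v).
Proof.
move=> Iq; elim: N e => [|N IH] e e0; first by exists e.
have [d1 d10 h1] := product_shift_continuous (iter N (T q) v) Iq e0.
have [d2 d20 h2] := IH _ d10.
exists (Num.min d1 d2); first by rewrite lt_min d10.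
move=> q' v' Iq' hq hv /=; apply: h1 => //.
  by move=> i; have := hq i; rewrite lt_min => /andP[].
apply: h2 => // i; first by have := hq i; rewrite lt_min => /andP[].
by have := hv i; rewrite lt_min => /andP[].
Qed.

(** The time [N] may vary with [q] but is common to all components and powers. Bounding the powers
    by [s] leaves finitely many strict inequalities for each [q], hence an open condition. *)
Definition hits (K : set R) (c : 'I_d -> R) (rho : R) (m s : nat) (eps : R)
    (v : 'I_d -> X) : set ('I_d -> X) :=
  [set u | forall q, (forall i, K (q i) /\ c i <= q i <= c i + rho) ->
    exists2 N, (0 < N)%N & forall i j, (m <= j <= s)%N ->
    Fnorm (iter N (backward_shift S (w (q i))) (upow S (u i) j)
      - (j == m)%:R *: v i) < eps].

(** The time that works for [q] and [u] works for all nearby [q'] and [u'] by joint continuity;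
    compactness of the parameter cube gives one radius for all [q]. *)
Lemma hits_open (K : set R) c rho m s eps v u : compact K -> K `<=` I ->
  hits K c rho m s eps v u ->
  exists2 dl : R, 0 < dl & forall u', close dl u' u -> hits K c rho m s eps v u'.
Proof.
move=> cK KI hu.
pose Q := [set q : {ptws 'I_d -> R} | forall i, (K `&` `[c i, c i + rho]) (q i)].
have cQ : compact Q.
  apply: (@tychonoff _ (fun _ : 'I_d => R) (fun i => K `&` `[c i, c i + rho])) => i.
  by apply: compact_closedI => //; exact: itv_closed.
have /compact_near_coveringP/near_covering_withinP cQ' := cQ.
have [|dl /= dl0 hdl] := cQ' _ (0^'+ : set_system R) (fun dl q => forall u',
    close dl u' u -> exists2 N, (0 < N)%N & forall i j, (m <= j <= s)%N ->
    Fnorm (iter N (backward_shift S (w (q i))) (upow S (u' i) j)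
      - (j == m)%:R *: v i) < eps) _ _.
  move=> q Qq; have Iq i : I (q i) by apply: KI; have [] := Qq i.
  have [|N N0 hN] := hu q.
    by move=> i; have [Kq] := Qq i; rewrite /= in_itv.
  (* The slack in each inequality; powers below [m] are unconstrained and get the default [1]. *)
  pose mg (t : 'I_d * 'I_s.+1) : R := if (m <= t.2)%N then eps -
     Fnorm (iter N (backward_shift S (w (q t.1))) (upow S (u t.1) t.2)
      - (t.2 == m :> nat)%:R *: v t.1) else 1.
  have mg0 t : 0 < mg t.
    rewrite /mg; case: ifP => // mt; rewrite subr_gt0; apply: hN.
    by rewrite mt -ltnS ltn_ord.
  have [e e0 he] := ord_min_pos mg0.
  have /choice[dj hdj] (j : 'I_s.+1) : exists dj : R, 0 < dj /\
      forall q' u', (forall i, I (q' i)) -> (forall i, `|q' i - q i| < dj) ->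
        close dj u' u ->
        close e (iter N (T q') (fun i => upow S (u' i) j))
                (iter N (T q) (fun i => upow S (u i) j)).
    have [d1 d10 h1] :=
      iter_product_shift_continuous N (fun i => upow S (u i) j) Iq e0.
    have /choice[d2 hd2] : forall i, exists d2 : R, 0 < d2 /\
        forall x, Fnorm (x - u i) < d2 -> Fnorm (upow S x j - upow S (u i) j) < d1.
      by move=> i; have [d2 d20 h2] := upow_continuous S hFnorm (u i) j d10; exists d2.
    have [d3 d30 hd3] := ord_min_pos (fun i => (hd2 i).1).
    exists (Num.min d1 d3); split; first by rewrite lt_min d10.
    move=> q' u' Iq' hq hu'; apply: h1 => // i.
      by have := hq i; rewrite lt_min => /andP[].
    apply: (hd2 i).2; apply: lt_le_trans (hd3 i).
    by have := hu' i; rewrite lt_min => /andP[].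
  have [dm dm0 hdm] := ord_min_pos (fun j => (hdj j).1).
  exists ([set q' : {ptws 'I_d -> R} | forall i, `|q' i - q i| < dm],
          [set x | x < dm]).
    split=> /=; last exact: nbhs_right_lt.
    by apply/(nbhs_ptws_ball (@nbhs_dist R)); exists dm.
  move=> [q' x] /= [hq' xdm] Qq' u' hu'.
  exists N => // i j /andP[mj js].
  have js' : (j < s.+1)%N by [].
  have Iq' i' : I (q' i') by apply: KI; have [] := Qq' i'.
  have := (hdj (Ordinal js')).2 q' u' Iq'.
  move=> /(_ _ _ i) /=; rewrite !iter_product_shift => hc.
  have {}hc : Fnorm (iter N (backward_shift S (w (q' i))) (upow S (u' i) j) -
     iter N (backward_shift S (w (q i))) (upow S (u i) j)) < e.
    apply: hc => i'; first exact: lt_le_trans (hq' i') (hdm _).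
    exact: lt_le_trans (lt_trans (hu' i') xdm) (hdm _).
  have := he (i, Ordinal js'); rewrite /mg /= mj => hmg.
  set a := iter N _ _ in hc *; set b := iter N _ _ in hc hmg.
  have -> : a - (j == m)%:R *: v i = (a - b) + (b - (j == m)%:R *: v i).
    by rewrite addrA subrK.
  apply: (le_lt_trans (FnormD hFnorm _ _)).
  by rewrite -ltrBrDr; exact: lt_le_trans hmg.
pose dl' := dl / 2; have dl'0 : 0 < dl' by rewrite divr_gt0.
exists dl' => // u' hu' q hq; apply: (hdl dl' _ dl'0 q _ u' hu').
  by rewrite /ball/= sub0r normrN gtr0_norm// ltr_pdivrMr// ltr_pMr// ltr1n.
by move=> i; have [Kq cq] := hq i; split=> //=; rewrite in_itv.
Qed.

End Openness.

Section Baire.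
Variables (R : realType) (X : topologicalLmodType R[i]).
Variables (S : coordwiseFrechetAlgebra X) (Fnorm : X -> R).
Hypotheses (hFnorm : is_Fnorm Fnorm).
Variable d : nat.
Local Notation Y := ('I_d -> X).
Local Notation close e u v := (forall i, Fnorm (u i - v i) < e).

Lemma Fnorm_Baire (G : nat -> set Y) :
  (forall n u, G n u -> exists2 dl : R, 0 < dl & forall v, close dl v u -> G n v) ->
  (forall n u (e : R), 0 < e -> exists2 v, close e v u & G n v) ->
  forall u (e : R), 0 < e ->
    exists2 v, (forall i, Fnorm (v i - u i) <= e) & forall n, G n v.
Proof.
move=> Gopen Gdense u e e0.
have step (t : nat * (Y * R)) : exists z : Y * R, 0 < t.2.2 ->
   [/\ 0 < z.2, z.2 <= t.2.2 / 2, close (t.2.2 / 2) z.1 t.2.1 &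
       forall v, (forall i, Fnorm (v i - z.1 i) <= z.2) -> G t.1 v].
  have [r0|r0] := ltP 0 t.2.2; last by exists t.2; rewrite ltNge r0.
  have r20 : 0 < t.2.2 / 2 by rewrite divr_gt0.
  have [v hv Gv] := Gdense t.1 t.2.1 _ r20.
  have [dl dl0 hdl] := Gopen _ _ Gv.
  (* Halving [dl] puts the closed ball inside the open one on which the condition holds. *)
  exists (v, Num.min (dl / 2) (t.2.2 / 2)) => _ /=; split => //.
  - by rewrite lt_min !divr_gt0.
  - by rewrite ge_min lexx orbT.
  - move=> z hz; apply: hdl => i; apply: (le_lt_trans (hz i)).
    by rewrite gt_min ltr_pdivrMr// ltr_pMr// ltr1n.
have [f hf] := choice step.
pose z := fix z n := if n is n'.+1 then f (n', z n') else (u, e).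
have z0 n : 0 < (z n).2.
  by elim: n => [//|n IH] /=; have [] := hf (n, z n) IH.
have zS n : [/\ (z n.+1).2 <= (z n).2 / 2,
    close ((z n).2 / 2) (z n.+1).1 (z n).1 &
    forall v, (forall i, Fnorm (v i - (z n.+1).1 i) <= (z n.+1).2) -> G n v].
  by have [] := hf (n, z n) (z0 n).
(* Each step moves by less than half the radius while the radius loses at least half, so
   displacements telescope and the limit stays in every closed ball. *)
have zdist n k i : Fnorm ((z (n + k)%N).1 i - (z n).1 i) <= (z n).2 - (z (n + k)%N).2.
  elim: k => [|k IH]; first by rewrite addn0 !subrr (Fnorm0 hFnorm).
  rewrite addnS; have [h1 h2 _] := zS (n + k)%N.
  have -> : (z (n + k).+1).1 i - (z n).1 i =
    ((z (n + k).+1).1 i - (z (n + k)%N).1 i) + ((z (n + k)%N).1 i - (z n).1 i).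
    by rewrite addrA subrK.
  apply: (le_trans (FnormD hFnorm _ _)).
  have := h2 i; set A := Fnorm (_ - _); set B := Fnorm (_ - _) in IH *.
  move: IH h1; set p := (z n).2; set q := (z (n + k)%N).2; set r := (z _.+1).2.
  lra.
have zr n : (z n).2 <= e / 2 ^+ n.
  elim: n => [|n IH]; first by rewrite expr0 divr1.
  have [h1 _ _] := zS n; apply: (le_trans h1).
  by rewrite exprSr invfM mulrA ler_wpM2r.
have small (x : R) : 0 < x -> exists n, (z n).2 < x.
  move=> x0; have x20 : 0 < x / 2 / e by rewrite !divr_gt0.
  have [|n hn] := @expr_small R 2^-1 _ _ x20.
    by rewrite invr_ge0 ler0n invf_lt1// ltr1n.
  exists n; apply: (le_lt_trans (zr n)); rewrite -exprVn.
  apply: (@le_lt_trans _ _ (x / 2)); last by rewrite ltr_pdivrMr// ltr_pMr// ltr1n.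
  by rewrite mulrC -ler_pdivlMr.
have lim i : exists l, forall x : R, 0 < x -> exists n0 : nat,
    forall n, (n0 <= n)%N -> Fnorm ((z n).1 i - l) < x.
  apply: (Fnorm_complete S hFnorm (u := fun n => (z n).1 i)) => x x0.
  have [n0 hn0] := small (x / 2) (divr_gt0 x0 (ltr0Sn _ _)).
  exists n0 => m n /subnKC <- /subnKC <-.
  set m' := (n0 + _)%N; set n' := (n0 + _)%N.
  have -> : (z m').1 i - (z n').1 i =
      ((z m').1 i - (z n0).1 i) - ((z n').1 i - (z n0).1 i).
    by rewrite opprB addrA subrK.
  apply: (le_lt_trans (FnormD hFnorm _ _)); rewrite (FnormN hFnorm).
  have h1 := zdist n0 (m - n0)%N i; have h2 := zdist n0 (n - n0)%N i.
  have h3 := z0 m'; have h4 := z0 n'.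
  rewrite -/m' in h1; rewrite -/n' in h2.
  move: h1 h2 h3 h4 hn0; set a := (z m').2; set b := (z n').2; set c := (z n0).2.
  set A := Fnorm _; set B := Fnorm _.
  lra.
have [l hl] := choice lim.
have ldist n i : Fnorm (l i - (z n).1 i) <= (z n).2.
  apply/ler_addgt0Pr => x x0; have [n0 hn0] := hl i _ x0.
  have := hn0 (n + n0)%N (leq_addl _ _); rewrite (FnormB hFnorm) => h1.
  rewrite -(subrK ((z (n + n0)%N).1 i) (l i)) -addrA.
  apply: (le_trans (FnormD hFnorm _ _)).
  have h2 := zdist n n0 i; have h3 := z0 (n + n0)%N.
  move: h1 h2 h3; set A := Fnorm (l i - _); set B := Fnorm _.
  set a := (z n).2; set b := (z _).2.
  lra.
exists l; first by move=> i; exact: (ldist 0%N).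
by move=> n; have [_ _] := zS n; apply; exact: ldist.
Qed.

End Baire.

(** * Targets and the generated algebra *)

Definition ratC (R : realType) (t : rat * rat) : R[i] := ratr t.1 +i* ratr t.2.

Lemma modulus_le (R : realType) (a b : R) : modulus (a +i* b) <= `|a| + `|b|.
Proof.
rewrite /modulus /= -(@ler_pXn2r _ 2)// ?nnegrE ?sqrtr_ge0 ?addr_ge0//.
rewrite sqr_sqrtr ?addr_ge0 ?sqr_ge0// sqrrD !real_normK ?num_real//.
have : 0 <= `|a| * `|b| by rewrite mulr_ge0.
lra.
Qed.

Lemma ratC_dense (R : realType) (z : R[i]) (e : R) : 0 < e ->
  exists t, modulus (ratC R t - z) <= e.
Proof.
case: z => a b e0; have e20 : 0 < e / 2 by rewrite divr_gt0.
have approx (x : R) : exists r : rat, `|ratr r - x| <= e / 2.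
  have [r] := @rat_in_itvoo R (x - e / 2) (x + e / 2) ltac:(lra).
  rewrite in_itv /= => /andP[r1 r2]; exists r.
  by rewrite ler_distl; apply/andP; split; lra.
have [r hr] := approx a; have [r' hr'] := approx b.
exists (r, r'); apply: (le_trans (modulus_le _ _)) => /=.
by rewrite (splitr e) lerD.
Qed.

Section Spans.
Variables (R : realType) (X : topologicalLmodType R[i]).
Variables (S : coordwiseFrechetAlgebra X) (Fnorm : X -> R).
Hypotheses (hFnorm : is_Fnorm Fnorm) (hspan : unit_vec_span_dense S).
Local Notation co := (seq_coord S).
Local Notation e_ := (unit_vec S).

Lemma span_dense x (e : R) : 0 < e -> exists n (c : nat -> R[i]),
  Fnorm (\sum_(l < n) c l *: e_ l - x) < e.
Proof.
move=> e0; pose O := interior [set y | Fnorm (y - x) < e].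
have xO : O x by apply/(nbhs_Fnorm hFnorm); exists e.
have [|y [Oy [n [c yE]]]] := hspan.2 O _ (open_interior _).
  by exists x.
by exists n, c; rewrite -yE; exact: (interior_subset Oy).
Qed.

(** Padding with zeros makes every large [p] admissible, so that one length fits all components. *)
Lemma ratC_span_dense x (e : R) : 0 < e -> exists s : seq (rat * rat),
  forall p, (size s <= p)%N ->
  Fnorm (\sum_(l < p) ratC R (nth (0, 0) s l) *: e_ l - x) < e.
Proof.
move=> e0; have e20 : 0 < e / 2 by rewrite divr_gt0.
have [n [c hc]] := span_dense x e20.
have en0 : 0 < e / 2 / n.+1%:R by rewrite divr_gt0// ltr0n.
have [dl dl0 hdl] := unit_vec_small S hFnorm n en0.
have /choice[t ht] l := @ratC_dense R (c l) _ dl0.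
exists (mkseq t n) => p; rewrite size_mkseq => np.
have rat0 : ratC R (0, 0) = 0 by rewrite /ratC /= rmorph0.
have -> : \sum_(l < p) ratC R (nth (0, 0) (mkseq t n) l) *: e_ l =
    \sum_(l < n) ratC R (t l) *: e_ l.
  rewrite (big_ord_widen _ (fun l => ratC R (t l) *: e_ l) np) [RHS]big_mkcond/=.
  apply: eq_bigr => l _; case: ifP => ln; first by rewrite nth_mkseq.
  by rewrite nth_default ?rat0 ?scale0r// size_mkseq leqNgt ln.
have -> : \sum_(l < n) ratC R (t l) *: e_ l - x =
   \sum_(l < n) (ratC R (t l) - c l) *: e_ l + (\sum_(l < n) c l *: e_ l - x).
  under [in RHS]eq_bigr do rewrite scalerBl.
  by rewrite sumrB addrA subrK.
apply: (le_lt_trans (FnormD hFnorm _ _)); rewrite (splitr e); apply: ler_ltD => //.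
apply: (le_trans (Fnorm_sum hFnorm _ _ _)).
apply: (@le_trans _ _ (\sum_(l < n) e / 2 / n.+1%:R)).
  by apply: ler_sum => l _; apply/ltW/hdl.
rewrite sumr_const card_ord -[leLHS]mulr_natr mulrAC ler_pdivrMr ?ltr0n//.
by rewrite ler_pM2l// ler_nat.
Qed.

End Spans.

Lemma compact_bigsetU (T : topologicalType) (K : nat -> set T) n :
  (forall i, compact (K i)) -> compact (\big[setU/set0]_(i < n) K i).
Proof.
move=> cK; elim: n => [|n IH]; first by rewrite big_ord0; exact: compact0.
by rewrite big_ord_recr /=; apply: compactU.
Qed.

Section PolynomialAlgebra.
Variables (R : realType) (X : topologicalLmodType R[i]).
Variables (S : coordwiseFrechetAlgebra X) (d : nat) (u : 'I_d -> X).
Local Notation co := (seq_coord S).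

(** The algebra generated by [u], described through coordinates: [p.[0] = 0] removes the constant
    term, and one polynomial serves all components. *)
Definition poly_algebra : set ('I_d -> X) :=
  [set x | exists2 p : {poly R[i]}, p.[0] = 0 &
    forall i n, co (x i) n = p.[co (u i) n]].

Lemma poly_algebra_subalgebra : subalgebra (prod_cmul S (d := d)) poly_algebra.
Proof.
split.
- by exists 0; rewrite ?horner0// => i n; rewrite horner0 [LHS]coord0.
- move=> x y [p p0 hp] [q q0 hq]; exists (p + q); first by rewrite hornerD p0 q0 addr0.
  by move=> i n; rewrite hornerD -hp -hq -coordD.
- move=> a x [p p0 hp]; exists (a *: p); first by rewrite hornerZ p0 mulr0.
  by move=> i n; rewrite hornerZ -hp -coordZ.
- move=> x y [p p0 hp] [q q0 hq]; exists (p * q); first by rewrite hornerM p0 mul0r.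
  by move=> i n; rewrite hornerM -hp -hq -seq_coord_cmul.
Qed.

Lemma poly_algebra_expand x : poly_algebra x -> x <> 0 ->
  exists (p : {poly R[i]}) (m : nat), [/\ (0 < m)%N, (m < size p)%N, p`_m != 0 &
    forall i, x i = \sum_(j < size p | (m <= j)%N) p`_j *: upow S (u i) j].
Proof.
move=> [p p0 hp] x0.
have pN0 : p != 0.
  apply/eqP => pE; apply: x0; apply/funext => i.
  by apply: (@coord_ext _ _ S) => n; rewrite hp pE horner0 [RHS]coord0.
have exm : exists m, p`_m != 0 by exists (size p).-1; rewrite -lead_coefE lead_coef_eq0.
case: (ex_minnP exm) => m pm mmin.
have m0 : (0 < m)%N.
  by rewrite lt0n; apply: contraNneq pm => ->; rewrite -horner_coef0 p0.
exists p, m; split => //.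
  by rewrite ltnNge; apply: contra pm => h; rewrite nth_default.
move=> i; apply: (@coord_ext _ _ S) => n.
rewrite hp horner_coef coord_sum [RHS]big_mkcond/=; apply: eq_bigr => j _.
case: ifPn => [mj|]; first by rewrite coordZ coord_upow// (leq_trans m0).
rewrite -ltnNge => jm; have : p`_j == 0.
  by apply: contraTT jm => /mmin; rewrite -leqNgt.
by move=> /eqP ->; rewrite mul0r.
Qed.

End PolynomialAlgebra.

Theorem theorem2p2 (R : realType) (X : topologicalLmodType R[i])
  (S : coordwiseFrechetAlgebra X)
  (Fnorm : X -> R) (hFnorm : is_Fnorm Fnorm)
  (hspan : unit_vec_span_dense S)
  (d : nat) (hd : (1 <= d)%N)
  (alpha : R) (halpha0 : 0 < alpha) (halphad : alpha < 1 / d%:R)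
  (I : set R) (hIpos : I `<=` [set a | 0 < a]) (hIsigma : sigma_compact I)
  (w : R -> nat -> R)
  (hweight : forall a, I a -> weight (w a))
  (hadm : forall a, I a -> admissible S (w a))
  (hcont : continuous_family S d I w)
  (H : forall (m : nat) (I0 : set R), (1 <= m)%N -> compact I0 -> I0 `<=` I ->
    exists (C1 C2 beta : R) (F : nat -> R) (N0 : nat) (M0 : R),
      [/\ 0 < C1, 0 < C2, alpha * d%:R < beta, (0 < N0)%N & 0 < M0] /\
      (forall n, (1 <= n)%N -> 0 < F n /\ F n <= C1 * n%:R `^ alpha) /\
      (forall n, (N0 <= n)%N ->
        [/\ (F n).-lipschitz_I0 (fun a : R => \sum_(1 <= i < n.+1) ln (w a i)),
            ereal_inf [set (weight_prod (w a) k)%:E | a in I0]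
              @[k --> \oo] --> +oo%E &
            forall a k, I0 a -> (N0 <= k)%N ->
              Fnorm ((expR (C2 * (F (n + k)%N / (n + k)%:R `^ alpha)
                              * k%:R `^ alpha)
                      / weight_prod (w a) k)%:C *: unit_vec S k)
                <= M0 / k%:R `^ beta
              /\
              Fnorm ((1 / weight_prod (w a) k `^ (1 / m%:R))%:C
                      *: unit_vec S k)
                <= M0 / k%:R `^ beta])) :
  common_hypercyclic_algebra S
    [set lam : 'I_d -> R | forall i, I (lam i)]
    (fun lam => product_shift S w lam).
Proof.
have ad1 : alpha * d%:R < 1 by rewrite -ltr_pdivlMr// ltr0n.
have [K cK IE] := hIsigma.
(* The components of a parameter may lie in different sets [K j]; a finite union contains them all
   and is still compact. *)
pose KU n := \big[setU/set0]_(j < n) K j.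
have cKU n : compact (KU n) by exact: compact_bigsetU.
have KUE n a : KU n a <-> exists2 j, (j < n)%N & K j a.
  by rewrite /KU -bigcup_mkord; split=> -[j jn Ka]; exists j.
have KUI n : KU n `<=` I.
  by move=> a /KUE[j _ Ka]; rewrite IE; exists j.
have wI n a : KU n a -> weight (w a) by move=> /KUI/hweight.
have aI n a : KU n a -> admissible S (w a) by move=> /KUI/hadm.
have wc n k a : (0 < k)%N -> KU n a ->
    w x k @[x --> within (KU n) (nbhs a)] --> w a k.
  move=> k0 Ka; have /subspace_continuousP/(_ a (KUI _ _ Ka)) := hcont.1 k k0.
  by apply: cvg_trans; apply: cvg_app; apply: within_subset; exact: KUI.
have hit (t : nat * nat) := hit_dense hFnorm hspan hd halpha0 ad1 (cKU t.1)
  (ltn0Sn t.2) (@wI t.1) (@aI t.1) (@wc t.1) (H _ _ (ltn0Sn t.2) (cKU t.1) (@KUI t.1)).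
have /choice[rho hrho] (t : nat * nat) : exists rho : R, 0 < rho /\
    forall (c : 'I_d -> R) (v : 'I_d -> nat -> R[i]) p s n1 (eps : R)
      (u0 : 'I_d -> X), 0 < eps ->
    (forall i n, (n1 <= n)%N -> seq_coord S (u0 i) n = 0) ->
    exists2 u : 'I_d -> X, (forall i, Fnorm (u i - u0 i) < eps) &
      hits S Fnorm w (KU t.1) c rho t.2.+1 s eps
        (fun i => \sum_(l < p) v i l *: unit_vec S l) u.
  have [rho rho0 hr] := hit t; exists rho; split=> // c v p s n1 eps u0 eps0 hu0.
  by have [u [h1 h2]] := hr c v p s n1 eps u0 eps0 hu0; exists u.
(* A countable index: compact set, lowest power minus one, cube of the grid with mesh [rho], length
   and rational coefficients of the target, and a number fixing both precision and highest power. *)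
pose idx := (nat * nat * {ffun 'I_d -> nat} * nat * {ffun 'I_d -> seq (rat * rat)} * nat)%type.
pose Hit (n m : nat) (z : {ffun 'I_d -> nat}) (p : nat)
    (t : {ffun 'I_d -> seq (rat * rat)}) (e : nat) : set ('I_d -> X) :=
  hits S Fnorm w (KU n) (fun i => (z i)%:R * rho (n, m)) (rho (n, m)) m.+1 (m + e).+1
    e.+1%:R^-1 (fun i => \sum_(l < p) ratC R (nth (0, 0) (t i) l) *: unit_vec S l).
pose G k : set ('I_d -> X) := if @unpickle idx k is Some (n, m, z, p, t, e)
  then Hit n m z p t e else setT.
have Gopen k u : G k u -> exists2 dl : R, 0 < dl &
    forall v, (forall i, Fnorm (v i - u i) < dl) -> G k v.
  rewrite /G; case: unpickle => [[[[[[n m] z] p] t] e]|_]; last by exists 1.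
  exact: (hits_open hFnorm hcont (cKU n) (@KUI n)).
have Gdense k (u : 'I_d -> X) (x : R) : 0 < x ->
    exists2 v, (forall i, Fnorm (v i - u i) < x) & G k v.
  move=> x0; rewrite /G; case: unpickle => [[[[[[n m] z] p] t] e]|]; last first.
    by exists u => // i; rewrite subrr (Fnorm0 hFnorm).
  have x20 : 0 < x / 2 by rewrite divr_gt0.
  have /choice[ln hln] i := span_dense hFnorm hspan (u i) x20.
  have /choice[cf hcf] := hln.
  pose u0 i := \sum_(l < ln i) cf i l *: unit_vec S l.
  have hu0 i k' : (\max_(i < d) ln i <= k')%N -> seq_coord S (u0 i) k' = 0.
    move=> hk; rewrite coord_sum big1// => l _; rewrite coordZ coord_unit//.
    have : (l < k')%N by rewrite (leq_trans (ltn_ord l))// (leq_trans _ hk)// leq_bigmax.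
    by rewrite ltn_neqAle eq_sym => /andP[/negbTE -> _]; rewrite mulr0.
  pose eps := Num.min (x / 2) e.+1%:R^-1.
  have eps0 : 0 < eps by rewrite lt_min x20 invr_gt0 ltr0n.
  have [v hv Hv] := (hrho (n, m)).2 (fun i => (z i)%:R * rho (n, m))
    (fun i l => ratC R (nth (0, 0) (t i) l)) p (m + e).+1 _ _ _ eps0 hu0.
  exists v.
    move=> i; rewrite -(subrK (u0 i) (v i)) -addrA.
    apply: (le_lt_trans (FnormD hFnorm _ _)); rewrite (splitr x).
    apply: ltrD; last exact: hcf.
    by apply: lt_le_trans (hv i) _; rewrite ge_min lexx.
  move=> q hq; have [N N0 hN] := Hv q hq; exists N => // i j mj.
  by apply: lt_le_trans (hN i j mj) _; rewrite ge_min lexx orbT.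
(* Starting Baire's construction at [e_0] with radius half its F-norm keeps the generator away from
   [0]. *)
have e00 : 0 < Fnorm (unit_vec S 0).
  rewrite lt_neqAle (Fnorm_ge0 hFnorm) andbT eq_sym; apply/eqP => /(Fnorm_eq0 hFnorm) h.
  have := coord_unit hspan 0 0; rewrite h coord0 eqxx => /eqP.
  by rewrite eq_sym oner_eq0.
have [u hu Gu] := Fnorm_Baire S hFnorm Gopen Gdense (fun=> unit_vec S 0)
  (divr_gt0 e00 (ltr0Sn _ 1)).
exists (poly_algebra S u); split; first exact: poly_algebra_subalgebra.
  exists u; first by exists 'X; rewrite ?hornerX// => i n; rewrite hornerX.
  move=> uE; have := hu (Ordinal hd); rewrite uE sub0r (FnormN hFnorm).
  by rewrite ler_pdivlMr// leNgt ltr_pMr// ltr1n.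
move=> x [Ax x0] q Iq O [y Oy] oO.
have [p [m [m0 mp pm xE]]] := poly_algebra_expand Ax x0.
have [eps eps0 heps] := (nbhs_ptws_ball (nbhs_Fnorm hFnorm) _ _).1
  (open_nbhs_nbhs (conj oO Oy)).
pose C := 1 + \sum_(j < size p) (modulus p`_j + 1).
have C1 : 1 <= C.
  by rewrite lerDl sumr_ge0// => j _; rewrite addr_ge0// modulus_ge0.
have eC0 : 0 < eps / 2 / C by rewrite !divr_gt0// (lt_le_trans _ C1).
have eP0 : 0 < eps / 2 / (modulus p`_m + 1).
  by rewrite !divr_gt0// ltr_wpDl// modulus_ge0.
(* The lowest term of the polynomial multiplies the target by its coefficient, so the target to
   approximate is [y i] divided by it. *)
have /choice[t ht] (i : 'I_d) := ratC_span_dense hFnorm hspan ((p`_m)^-1 *: y i) eP0.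
have /choice[nn hnn] (i : 'I_d) : exists n, K n (q i).
  by have := Iq i; rewrite IE => -[n _ Kn]; exists n.
pose n := (\max_(i < d) nn i).+1.
have rho0 := (hrho (n, m.-1)).1.
(* The grid cube containing [q]; parameters are positive, so natural indices suffice. *)
pose z i := Num.truncn (q i / rho (n, m.-1)).
pose e0 := Num.bound (eps / 2 / C)^-1.
(* [size p] covers all powers in the polynomial, [e0] makes the precision at most [eps / 2 / C]. *)
pose e := maxn (size p) e0.
pose P := \max_(i < d) size (t i).
have := Gu (pickle ((n, m.-1, [ffun i => z i], P, [ffun i => t i], e) : idx)).
rewrite /G pickleK /Hit => hG.
have [i|N N0 hN] := hG q.
  split; first by apply/KUE; exists (nn i) => //; rewrite ltnS leq_bigmax.
  have q0 : 0 <= q i / rho (n, m.-1).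
    by rewrite divr_ge0 ?(ltW rho0)// ltW//; exact: hIpos.
  have := truncn_itv q0; rewrite ffunE /z => /andP[h1 h2]; apply/andP; split.
    by rewrite -ler_pdivlMr.
  by rewrite -[X in _ + X]mul1r -mulrDl natr1 -ler_pdivrMr// ltW.
exists (iter N (product_shift S w q) x); split; last by exists N.
apply: heps => i; rewrite iter_product_shift xE.
have hqi := hadm _ (Iq i); have wqi := hweight _ (Iq i).
rewrite (iter_shift_sum wqi hqi).
pose v i := \sum_(l < P) ratC R (nth (0, 0) (t i) l) *: unit_vec S l.
have ee : e.+1%:R^-1 <= eps / 2 / C.
  rewrite -[leRHS]invrK lef_pV2 ?posrE ?ltr0n ?invr_gt0//.
  apply: (le_trans (ltW (archi_boundP _))); first by rewrite invr_ge0 ltW.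
  by rewrite ler_nat leqW// leq_maxr.
under eq_bigr do rewrite (iter_shiftZ wqi hqi).
set B := backward_shift S (w (q i)).
(* The error splits into the hitting errors of the separate powers and the error of approximating
   the target by rational coefficients, each given half of [eps]. *)
have -> : \sum_(j < size p | (m <= j)%N) p`_j *: iter N B (upow S (u i) j) - y i =
  \sum_(j < size p | (m <= j)%N) p`_j *: (iter N B (upow S (u i) j)
     - (j == m :> nat)%:R *: v i) + p`_m *: (v i - (p`_m)^-1 *: y i).
  rewrite scalerBr scalerA divff// scale1r addrA; congr (_ - _).
  under [in RHS]eq_bigr do rewrite scalerBr.
  rewrite sumrB [X in _ = _ - X + _](bigD1 (Ordinal mp))//= eqxx scale1r.
  rewrite [X in _ = _ - (_ + X) + _]big1 ?addr0 ?subrK// => j /andP[_ jm].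
  rewrite (_ : (j == m :> nat) = false) ?scale0r ?scaler0//.
  by apply: contraNF jm => /eqP jm; apply/eqP/val_inj.
apply: (le_lt_trans (FnormD hFnorm _ _)); rewrite (splitr eps); apply: ler_ltD.
  apply: (le_trans (Fnorm_sum hFnorm _ _ _)).
  apply: (@le_trans _ _ (\sum_(j < size p) (modulus p`_j + 1) * (eps / 2 / C))).
    rewrite big_mkcond/=; apply: ler_sum => j _.
    have pj0 : 0 <= modulus p`_j + 1 by rewrite addr_ge0// modulus_ge0.
    case: ifP => [mj|_]; last by rewrite mulr_ge0// ltW.
    apply: (le_trans (Fnorm_scale_le hFnorm _ (lexx _))); rewrite ler_wpM2l//.
    apply: le_trans ee; apply: ltW.
    have := hN i j; rewrite ffunE prednK//; apply.
    rewrite mj/= -addSn prednK// (leq_trans (ltnW (ltn_ord j)))//.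
    by rewrite (leq_trans (leq_maxl _ e0))// leq_addl.
  rewrite -mulr_suml mulrC mulrAC ler_pdivrMr ?(lt_le_trans _ C1)//.
  by rewrite ler_wpM2l ?(ltW (divr_gt0 _ _))// lerDr.
apply: (le_lt_trans (Fnorm_scale_le hFnorm _ (lexx _))).
rewrite mulrC -ltr_pdivlMr ?ltr_wpDl ?modulus_ge0//.
by apply: ht; rewrite leq_bigmax.
Qed.
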